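(* Let $G=(V(G),E(G))$ be a finite, simple, non-oriented, connected graph (with at least one edge) and let $C_0>0$. For every $x\in V(G)$, the series $\tilde\Psi_G(x)=\sum_{k\ge0}\xi_G^k(x)$ (defined in the context) converges in $L^2(P)$ and $P$-almost surely, and the law of $\tilde\Psi_G=(\tilde\Psi_G(x))_{x\in V(G)}$ agrees with the law of $\Psi_G$; that is, $\tilde\Psi_G$ is a zero-average Gaussian free field on $G$.
   Context: Zero-average Gaussian free field: let $\bar P_x^G$ be the law of the lazy simple random walk $(X_k)_{k\ge0}$ on $G$ started at $x$: from a vertex $y$ it stays at $y$ with probability $\frac12$ and jumps to each neighbour of $y$ with probability $\frac1{2\deg_G(y)}$. Let $\pi_G(x)=\deg_G(x)/(2|E(G)|)$ and $\bar g_G(x,y)=\frac1{\deg_G(y)}\sum_{k\ge0}(\bar P_x^G(X_k=y)-\pi_G(y))$. The zero-average Gaussian free field $\Psi_G=(\Psi_G(x))_{x\in V(G)}$ is the centred Gaussian process with covariance $E(\Psi_G(x)\Psi_G(y))=C_0\,\bar g_G(x,y)$, with $C_0>0$ a fixed constant. Subdivided graph: $\tilde G$ is obtained from $G$ by adding a vertex in the middle of every edge: $V(\tilde G)=V(G)\cup E(G)$, and $E(\tilde G)=\{(x,e):x\in V(G),e\in E(G),e\ni x\}$. Let $\tilde\pi_G(\tilde x)=\deg_{\tilde G}(\tilde x)$, which equals $\deg_G(\tilde x)$ if $\tilde x\in V(G)$ and $2$ if $\tilde x\in E(G)$. Let $\tilde Q_G(\tilde x,\tilde y)=\mathbf 1_{(\tilde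 x,\tilde y)\in E(\tilde G)}/\tilde\pi_G(\tilde x)$ be the transition matrix of the simple random walk on $\tilde G$, acting on $\ell^2(\tilde\pi_G)$ by $\tilde Q_Gf(\tilde x)=\sum_{\tilde y}\tilde Q_G(\tilde x,\tilde y)f(\tilde y)$. Let $\mathbf 1$ be the constant function one on $V(\tilde G)$, $w(\tilde x)=1$ for $\tilde x\in V(G)$ and $w(\tilde x)=-1$ for $\tilde x\in E(G)$, and let $\Pi_G$ be the orthogonal projection in $\ell^2(\tilde\pi_G)$ onto $\mathrm{span}(\mathbf 1,w)$. For a linear operator $A$ on functions on $V(\tilde G)$, $A(\tilde x,\tilde y)$ denotes its matrix entries, $(Af)(\tilde x)=\sum_{\tilde y}A(\tilde x,\tilde y)f(\tilde y)$. Let $(Z_k(\tilde x))_{k\ge0,\tilde x\in V(\tilde G)}$ be independent centred Gaussian random variables on a probability space $(\Omega,\mathcal A,P)$ with $\mathrm{Var}\,Z_k(\tilde x)=C_0/\tilde\pi_G(\tilde x)$, and for $x\in V(G)$ set $\xi_G^k(x)=\sum_{\tilde y\in V(\tilde G)}((\mathrm{Id}-\Pi_G)\tilde Q_G^k)(x,\tilde y)Z_k(\tilde y)$. *)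

(* Defs.v *)
From HB Require Import structures.
From mathcomp Require Import all_boot all_order all_algebra.
From mathcomp Require Import all_classical all_reals all_analysis.
From mathcomp Require Import ring.

Set Implicit Arguments.
Unset Strict Implicit.
Unset Printing Implicit Defensive.

Import Order.TTheory GRing.Theory Num.Theory.
Import numFieldNormedType.Exports.

Local Open Scope classical_set_scope.
Local Open Scope ring_scope.

(* A finite simple graph is given by a symmetric irreflexive [adj : rel V] on
   a finType [V]; an edge is the two-element set of its endpoints. *)

Definition deg (V : finType) (adj : rel V) (x : V) : nat :=
  #|[set y | adj x y]%SET|.

Definition edges (V : finType) (adj : rel V) : {set {set V}} :=
  [set A : {set V} |
    [exists x, exists y, adj x y && (A == [set x; y]%SET)]]%SET.

Section lazy_walk.
Context (R : realType) (V : finType) (adj : rel V).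
Implicit Types x y : V.

Definition lazy_step x y : R :=
  if x == y then 2^-1 else if adj x y then (2 * (deg adj x)%:R)^-1 else 0.

(* probability that the lazy walk started at [x] makes its first [size s] steps
   to the successive vertices listed in [s] *)
Fixpoint lazy_path_prob x (s : seq V) : R :=
  if s is y :: s' then lazy_step x y * lazy_path_prob y s' else 1.

(* \bar P_x (X_k = y) *)
Definition lazy_prob (k : nat) x y : R :=
  \sum_(s : k.-tuple V | last x s == y) lazy_path_prob x s.

Definition stationary x : R := (deg adj x)%:R / (2 * #|edges adj|%:R).

Definition green x y : R :=
  ((deg adj y)%:R)^-1 *
  limn (series (fun k => lazy_prob k x y - stationary y)).

End lazy_walk.

Section subdivision.
Context (V : finType) (adj : rel V).

Definition edge : Type := {A : {set V} | A \in edges adj}.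
HB.instance Definition _ := Finite.on edge.

(* the vertices [inl x] of G and the midpoints [inr e] of its edges *)
Definition subdiv : Type := (V + edge)%type.
HB.instance Definition _ := Finite.on subdiv.

Definition sub_adj : rel subdiv := fun a b =>
  match a, b with
  | inl x, inr e | inr e, inl x => x \in val e
  | _, _ => false
  end.

End subdivision.

Section subdivision_operators.
Context (R : realType) (V : finType) (adj : rel V).
Local Notation W := (subdiv adj).
Implicit Types (a b : W) (f g p : W -> R).

Definition sub_pi a : R := (deg (@sub_adj V adj) a)%:R.

Definition sub_Q a b : R := (sub_adj a b)%:R / sub_pi a.

Definition sub_Qop f : W -> R := fun a => \sum_b sub_Q a b * f b.

Definition sub_dot f g : R := \sum_a sub_pi a * (f a * g a).

Definition sub_sign : W -> R := fun a => if a is inl _ then 1 else -1.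

Definition span_one_sign : set (W -> R) :=
  [set p | exists c c' : R, forall a, p a = c + c' * sub_sign a].

Definition is_sub_proj f p :=
  span_one_sign p /\
  forall g, span_one_sign g -> sub_dot (fun a => f a - p a) g = 0.

(* [is_sub_proj f] always has a solution, see [sub_projP]; it is unique as soon
   as no vertex is isolated. *)
Definition sub_proj f : W -> R := xget (cst 0) (is_sub_proj f).

Definition entry (A : (W -> R) -> W -> R) a b : R :=
  A (fun c => (c == b)%:R) a.

Definition xi_kernel (k : nat) a b : R :=
  entry (fun f => iter k sub_Qop f \- sub_proj (iter k sub_Qop f)) a b.

Lemma sub_sign_dot1 : \sum_a sub_pi a * sub_sign a = 0.
Proof.
rewrite big_sumType /=.
have cardE (T : finType) (p : pred T) : (#|p|%:R : R) = \sum_(i : T) (p i)%:R.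
  rewrite -sum1_card natr_sum big_mkcond /=.
  by apply: eq_bigr => i _; rewrite unfold_in; case: (p i).
have -> : \sum_(i : V) sub_pi (inl i) * 1 =
          \sum_(i : V) \sum_(e : edge adj) ((i \in val e)%:R : R).
  apply: eq_bigr => i _; rewrite mulr1 /sub_pi /deg cardsE cardE big_sumType /=.
  by rewrite big1 ?add0r.
have -> : \sum_(e : edge adj) sub_pi (inr e) * -1 =
          - \sum_(e : edge adj) \sum_(i : V) ((i \in val e)%:R : R).
  rewrite -sumrN; apply: eq_bigr => e _.
  rewrite mulrN1 /sub_pi /deg cardsE cardE big_sumType /=.
  by congr (- _); rewrite [X in _ + X]big1 ?addr0.
by rewrite exchange_big /= subrr.
Qed.

Lemma sub_projP f : is_sub_proj f (sub_proj f).
Proof.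
apply: xgetPex; pose S := \sum_a sub_pi a.
pose A := \sum_a sub_pi a * f a; pose B := \sum_a sub_pi a * (f a * sub_sign a).
exists (fun a => A / S + B / S * sub_sign a); split; first by exists (A / S), (B / S).
move=> g [c [c' gE]].
have sign2 a : sub_sign a * sub_sign a = 1.
  by case: a => ? /=; rewrite ?mulr1// mulrNN mulr1.
rewrite /sub_dot.
under eq_bigr => a _.
  rewrite gE.
  have -> : sub_pi a * ((f a - (A / S + B / S * sub_sign a)) *
      (c + c' * sub_sign a)) =
    c * (sub_pi a * f a) + c' * (sub_pi a * (f a * sub_sign a))
    - (c * (A / S) + c' * (B / S)) * sub_pi a
    - (c' * (A / S) + c * (B / S)) * (sub_pi a * sub_sign a).
    have := sign2 a; move: (sub_sign a) (f a) (sub_pi a) => s u v s2.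
    transitivity (c * (v * u) + c' * (v * (u * s)) - c * (A / S) * v
      - c' * (B / S) * v * (s * s) - (c' * (A / S) + c * (B / S)) * (v * s)).
      by ring.
    by rewrite s2; ring.
  over.
rewrite !big_split /= !sumrN -!mulr_sumr sub_sign_dot1 mulr0 subr0 -/A -/B -/S.
have [S0|S0] := eqVneq S 0; last by field.
have pi0 a : sub_pi a = 0.
  by apply/eqP; have /eqP := S0; rewrite psumr_eq0// => /allP; exact.
have -> : A = 0 by rewrite /A big1 // => a _; rewrite pi0 mul0r.
have -> : B = 0 by rewrite /B big1 // => a _; rewrite pi0 mul0r.
by rewrite !(mul0r, mulr0) !addr0 mul0r subr0.
Qed.

End subdivision_operators.

Section probability.
Context (R : realType).

(* The library's [normal_prob m s] has standard deviation [s], and for [s = 0]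
   it is not the Dirac mass. *)
Definition gaussian_law (m v : R) : set R -> \bar R :=
  if v == 0 then dirac m else normal_prob m (Num.sqrt v).

Definition is_gaussian d (T : measurableType d) (P : probability T R)
    (X : T -> R) (m v : R) :=
  0 <= v /\
  forall A : set R, measurable A -> P (X @^-1` A) = gaussian_law m v A.

Definition mutually_independent d (T : measurableType d) (P : probability T R)
    (I : eqType) (X : I -> {RV P >-> R}) :=
  forall (s : seq I) (B : I -> set R), uniq s ->
    (forall i, measurable (B i)) ->
    P (\bigcap_(i in [set` s]) (X i @^-1` B i)) =
    (\prod_(i <- s) P (X i @^-1` B i))%E.

Definition centred_gaussian_process d (T : measurableType d)
    (P : probability T R) (V : finType) (K : V -> V -> R)
    (X : V -> {RV P >-> R}) :=
  [/\ forall a : V -> R, exists m v : R,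
        is_gaussian P (fun w => \sum_x a x * X x w) m v,
      forall x, ('E_P[X x] = 0)%E &
      forall x y, ('E_P[(fun w => X x w * X y w)%R] = (K x y)%:E)%E].

Definition zero_average_gff d (T : measurableType d) (P : probability T R)
    (V : finType) (adj : rel V) (C0 : R) (X : V -> {RV P >-> R}) :=
  centred_gaussian_process (fun x y => C0 * green R adj x y) X.

(* product sigma-algebra on R^V *)
Definition cylinder_sigma_algebra (V : finType) : set (set (V -> R)) :=
  <<s [set A | exists (x : V) (B : set R),
         measurable B /\ A = [set f | B (f x)]] >>.

Definition process_law d (T : measurableType d) (P : probability T R)
    (V : finType) (X : V -> {RV P >-> R}) (A : set (V -> R)) : \bar R :=
  P [set w | A (fun x => X x w)].

Definition same_law d (T : measurableType d) (P : probability T R)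
    d' (T' : measurableType d') (P' : probability T' R)
    (V : finType) (X : V -> {RV P >-> R}) (Y : V -> {RV P' >-> R}) :=
  forall A, cylinder_sigma_algebra A -> process_law X A = process_law Y A.

Definition xi d (T : measurableType d) (P : probability T R)
    (V : finType) (adj : rel V) (Z : nat -> subdiv adj -> {RV P >-> R})
    (k : nat) (x : V) (w : T) : R :=
  \sum_(b : subdiv adj) xi_kernel R k (inl x) b * Z k b w.

End probability.

(* Main.v *)
(* On V(G), two steps of the walk on the subdivided graph make one step of the
   lazy walk, and the walk on the subdivided graph is reversible; hence xi^k has
   covariance C_0 (P_x(X_k = y) - pi(y)) / deg(y), and summing over k gives
   C_0 g(x, y).  By Doeblin's condition these covariances decay geometrically in
   k, whence the convergence of the series.  The laws of the Gaussian limits are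
   identified through E cos(tX + b): no complex characteristic function is
   needed, and these expectations, for X a linear combination of the
   coordinates, determine the law of a process indexed by V. *)

Require Import Defs.
From HB Require Import structures.
From mathcomp Require Import all_boot all_order all_algebra.
From mathcomp Require Import all_classical all_reals all_analysis.
From mathcomp Require Import measurable_realfun ring lra.

Set Implicit Arguments.
Unset Strict Implicit.
Unset Printing Implicit Defensive.

Import Order.TTheory GRing.Theory Num.Theory.
Import numFieldNormedType.Exports.

Local Open Scope classical_set_scope.
Local Open Scope ring_scope.

(** * Moments and characteristic function of the normal law *)

(** The subdivided graph is bipartite, so its walk has the eigenvalues 1 and -1, with eigenfunctions
    1 and w, and neither mode decays; [Id - Pi] removes exactly these two. Both eigenfunctions equal
    1 on V(G), so at the midpoint of an even time 2k they contribute alike, and together they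
    account for the single term pi(y) of the lazy walk. The obstacle on the Gaussian side is
    degeneracy. The sum of deg(x) Psi(x) over x has variance zero, so the field never has a joint
    density, and a single xi^k may vanish almost surely. Gaussianity is therefore tested on linear
    combinations, with variance zero allowed everywhere. The free phase b in E cos(tX + b) replaces
    the imaginary part of a characteristic function: sines are cosines with phase shifted by pi/2,
    so addition formulas and products of cosines stay inside the family. Being bounded and
    continuous, these functions also carry Gaussianity through almost sure limits. *)

Section normal_density_integral.
Context (R : realType) (m s : R).
Notation mu := lebesgue_measure.
Local Open Scope ereal_scope.

(** The Radon-Nikodym derivative of [normal_prob] agrees almost everywhere with [normal_pdf], since
    both have the same integral over every measurable set. *)
Lemma ge0_integral_normal_prob (f : R -> \bar R) :
  measurable_fun setT f -> (forall x, 0 <= f x) ->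
  \int[normal_prob m s]_x f x = \int[mu]_x (f x * (normal_pdf m s x)%:E).
Proof.
move=> mf f0.
rewrite -(Radon_Nikodym_SigmaFinite.change_of_variables
  (normal_prob_dominates m s))//.
apply: ae_eq_integral => //.
- apply: emeasurable_funM => //; apply: (measurable_int mu).
  exact: Radon_Nikodym_SigmaFinite.f_integrable (normal_prob_dominates m s).
- apply: emeasurable_funM => //=; apply/measurableT_comp => //=.
  exact: measurable_normal_pdf.
- apply: ae_eqe_mul2l => /=; apply: integral_ae_eq => //.
  + exact: Radon_Nikodym_SigmaFinite.f_integrable (normal_prob_dominates m s).
  + by apply/measurableT_comp =>//; exact: measurable_normal_pdf.
  + move=> E _ mE.
    by rewrite -(Radon_Nikodym_SigmaFinite.f_integral (normal_prob_dominates m s)).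
Qed.

Lemma integrable_normal_prob (f : R -> R) :
  measurable_fun setT f ->
  mu.-integrable setT (fun x => (f x * normal_pdf m s x)%:E) ->
  (normal_prob m s).-integrable setT (EFin \o f).
Proof.
move=> mf /integrableP[_ fi]; apply/integrableP; split.
  exact/measurable_EFinP.
rewrite ge0_integral_normal_prob//=; last first.
  by apply/measurable_EFinP; exact: measurableT_comp.
apply: le_lt_trans fi; rewrite le_eqVlt; apply/orP; left; apply/eqP.
apply: eq_integral => x _ /=.
by rewrite normrM [X in (_ * X)%R]ger0_norm ?normal_pdf_ge0.
Qed.

Lemma Rintegral_normal_prob (f : R -> R) :
  measurable_fun setT f ->
  mu.-integrable setT (fun x => (f x * normal_pdf m s x)%:E) ->
  (\int[normal_prob m s]_x f x = \int[mu]_x (f x * normal_pdf m s x))%R.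
Proof.
move=> mf fi; have ni := integrable_normal_prob mf fi.
have nge0 := normal_pdf_ge0 m s.
have mp : measurable_fun setT (normal_pdf m s) by exact: measurable_normal_pdf.
have posneg (g : R -> R) x : (g x)%:E = (EFin \o g)^\+ x - (EFin \o g)^\- x.
  exact: (congr1 (@^~ x) (funeposneg (EFin \o g))).
congr fine; under eq_integral => x _ do rewrite posneg.
rewrite integralB//; [|exact: integrable_funepos|exact: integrable_funeneg].
rewrite !ge0_integral_normal_prob//; last 2 first.
  by apply: measurable_funeneg; exact/measurable_EFinP.
  by apply: measurable_funepos; exact/measurable_EFinP.
pose g x := (f x * normal_pdf m s x)%R.
have pE : (fun x => (EFin \o f)^\+ x * (normal_pdf m s x)%:E) = (EFin \o g)^\+.
  apply/funext => x; rewrite unlock /= -!EFin_max -EFinM; congr EFin.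
  by rewrite maxr_pMl// mul0r.
have nE : (fun x => (EFin \o f)^\- x * (normal_pdf m s x)%:E) = (EFin \o g)^\-.
  apply/funext => x; rewrite unlock /= -!EFin_max -EFinM; congr EFin.
  by rewrite maxr_pMl// mul0r mulNr.
rewrite pE nE -integralB//;
  [|exact: integrable_funepos|exact: integrable_funeneg].
by apply: eq_integral => x _; rewrite -posneg.
Qed.

End normal_density_integral.

(** The form in which integration by parts is used below. On [[-(n+1), n+1]] the integral of [f] is
    a difference of two boundary values of [F], each at most K/(n+1); dominated convergence lets n
    grow. *)
Lemma Rintegral_derive_eq0 (R : realType) (F f : R -> R) (K : R) :
  (forall x, is_derive x (1 : R) F (f x)) -> continuous f ->
  lebesgue_measure.-integrable setT (EFin \o f) ->
  (forall x, `|F x| * `|x| <= K) ->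
  (\int[lebesgue_measure]_x f x)%R = 0.
Proof.
move=> dF cf fi FK; set mu := lebesgue_measure.
pose A (n : nat) : set R := `[- n.+1%:R, n.+1%:R]%classic.
have mA n : measurable (A n) by exact: measurable_itv.
have intA n : (\int[mu]_x ((EFin \o f) \_ (A n)) x =
    (F n.+1%:R)%:E - (F (- n.+1%:R))%:E)%E.
  rewrite -integral_mkcond; apply: continuous_FTC2.
  - by rewrite ltrNl (lt_trans (_ : _ < 0))// ?oppr_lt0 ltr0n.
  - by apply: continuous_subspaceT => x; exact: cf.
  - have cF x : {for x, continuous F}.
      by apply/differentiable_continuous/derivable1_diffP; have [] := dF x.
    split; first by move=> x _; have [] := dF x.
      exact: cvg_at_right_filter (cF _).
    exact: cvg_at_left_filter (cF _).
  - by move=> x _; rewrite derive1E; have [_ ->] := dF x.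
have F0 : (fun n => F n.+1%:R - F (- n.+1%:R)) @ \oo --> (0 : R).
  apply/norm_cvg0P; apply: (@squeeze_cvgr _ _ _ _ (cst 0) (fun n => K * 2 * harmonic n)).
  - near=> n; rewrite normr_ge0 /= (le_trans (ler_normB _ _))//.
    rewrite /harmonic/= -mulrA mulrCA mulrDl mul1r.
    apply: lerD; rewrite ler_pdivlMr ?ltr0n//.
      by have := FK n.+1%:R; rewrite [`|_.+1%:R|]ger0_norm.
    by have := FK (- n.+1%:R); rewrite [`|- _.+1%:R|]normrN [`|_.+1%:R|]ger0_norm.
  - exact: cvg_cst.
  - rewrite -[X in _ --> X](mulr0 (K * 2)).
    by apply: cvgM; [exact: cvg_cst|exact: cvg_harmonic].
have mf : measurable_fun setT f by exact: continuous_measurable_fun.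
have [|||||_ _ dct] := @dominated_convergence _ _ _ mu setT measurableT
  (fun n => (EFin \o f) \_ (A n)) (EFin \o f) (fun x => `|f x|%:E).
- move=> n; apply: (iffLR (measurable_restrictT _ (mA n))).
  by apply/measurable_EFinP/measurable_funTS.
- exact/measurable_EFinP.
- apply: aeW => x _; apply: cvg_near_cst; near=> n.
  rewrite patchE mem_set//= /A /= in_itv /= -ler_norml.
  rewrite (le_trans (ltW (_ : _ < n%:R)))// ?ler_nat//.
  by near: n; exact: nbhs_infty_gtr.
- exact: integrable_norm.
- by apply: aeW => x n _ /=; rewrite patchE; case: ifP => _ /=; rewrite ?normr0 ?lee_fin.
move: dct; under eq_fun do rewrite intA -EFinB.
have : (F n.+1%:R - F (- n.+1%:R))%:E @[n --> \oo] --> (0:R)%:E.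
  by apply: cvg_EFin => //; exact: nearW.
by move=> /cvg_lim lim0 /cvg_lim lim1; rewrite /Rintegral -lim1// lim0.
Unshelve. all: end_near. Qed.

Section real_derivatives.
Context (R : realType).
Implicit Types (f g : R -> R) (x a b : R).

Lemma is_derive1M f g x a b : is_derive x (1 : R) f a -> is_derive x (1 : R) g b ->
  is_derive x (1 : R) (fun y => f y * g y) (a * g x + f x * b).
Proof.
move=> df dg; apply: (is_derive_eq (is_deriveM df dg)).
by rewrite addrC /GRing.scale /= (mulrC (g x)).
Qed.

Lemma is_derive1_affine (c d x : R) :
  is_derive x (1 : R) (fun y : R => c * y + d) c.
Proof.
have D := is_deriveD (is_deriveZ c (is_derive_id x (1 : R))) (is_derive_cst d x (1 : R)).
by apply: (is_derive_eq D); rewrite addr0 /GRing.scale /= mulr1.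
Qed.

End real_derivatives.

Section normal_pdf_calculus.
Context (R : realType) (m s : R).
Hypothesis s0 : s != 0.
Local Notation mu := (@lebesgue_measure R).
Local Notation p := (normal_pdf m s).

Lemma is_derive_normal_pdf (x : R) :
  is_derive x (1 : R) p (- ((x - m) / s ^+ 2 * p x)).
Proof.
rewrite normal_pdfE//.
have dc := is_derive1_affine 1 (- m) x.
have dq := is_derive1M (is_derive_cst (- (s ^+ 2 *+ 2)^-1) x (1 : R)) (is_derive1M dc dc).
have de := @is_derive1_comp _ expR _ x _ _ (is_derive_expR _) dq.
have := is_derive1M (is_derive_cst (normal_peak s) x (1 : R)) de.
rewrite /= (_ : (fun y => _) = (fun y => normal_peak s * normal_fun m s y)); last first.
  apply/funext => y; rewrite /normal_fun /=; congr (_ * expR _).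
  by rewrite mul1r mulNr [RHS]mulrC mulrN expr2.
move=> D; apply: (is_derive_eq D); rewrite /normal_fun !mul0r !add0r /= !mul1r mulr1.
rewrite (_ : - (s ^+ 2 *+ 2)^-1 * ((x - m) * (x - m)) = - (x - m) ^+ 2 / (s ^+ 2 *+ 2)); last first.
  by rewrite mulNr [RHS]mulrC mulrN expr2.
by move: (expR _) => e; field.
Qed.

(* [u <= exp u] at [u = 3 (x - m)^2 / (8 s^2)] costs only a wider Gaussian *)
Lemma sqr_normal_pdf_le (x : R) :
  (x - m) ^+ 2 * p x <= 16 * s ^+ 2 * normal_pdf m (2 * s) x.
Proof.
have s20 : 2 * s != 0 by rewrite mulf_neq0.
rewrite !normal_pdfE//.
have -> : normal_peak (2 * s) = normal_peak s / 2.
  rewrite /normal_peak exprMn -mulrA -mulrnAr sqrtrM ?sqr_ge0// sqrtr_sqr ger0_norm//.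
  by rewrite invfM mulrC.
rewrite /normal_fun; set e := (x - m) ^+ 2.
have e0 : 0 <= e by exact: sqr_ge0.
have s2 : 0 < s ^+ 2 by rewrite exprn_even_gt0.
(* 1/(2s^2) - 1/(2(2s)^2) = 3/(8s^2): doubling the standard deviation frees this part of the
   exponent to absorb the square. *)
have -> : - e / (s ^+ 2 *+ 2) = - (3 * e / (8 * s ^+ 2)) + - e / ((2 * s) ^+ 2 *+ 2).
  by field.
rewrite expRD expRN.
set u := 3 * e / (8 * s ^+ 2); set w := expR (- e / _).
have u0 : 0 <= u.
  by apply: divr_ge0; apply: mulr_ge0 => //; exact: ltW.
have uE : u <= expR u by apply: le_trans (expR_ge1Dx u); rewrite lerDr.
have eE : e = 8 / 3 * s ^+ 2 * u by rewrite /u; field.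
rewrite {1}eE.
have -> : 8 / 3 * s ^+ 2 * u * (normal_peak s * ((expR u)^-1 * w)) =
  (8 * s ^+ 2 * (normal_peak s * w)) * (u / expR u / 3).
  by field; rewrite gt_eqF ?expR_gt0.
have -> : 16 * s ^+ 2 * (normal_peak s / 2 * w) = 8 * s ^+ 2 * (normal_peak s * w) * 1.
  by field.
apply: ler_wpM2l.
  apply: mulr_ge0; first by apply: mulr_ge0 => //; exact: ltW.
  by apply: mulr_ge0; [exact: normal_peak_ge0|exact: expR_ge0].
rewrite ler_pdivrMr// mul1r (@le_trans _ _ 1)// ?ler1n//.
by rewrite ler_pdivrMr ?expR_gt0// mul1r.
Qed.

Lemma sqr_normal_pdf_ub : exists K, forall x, (x - m) ^+ 2 * p x <= K.
Proof.
exists (16 * s ^+ 2 * normal_peak (2 * s)) => x.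
apply: le_trans (sqr_normal_pdf_le x) _.
apply: ler_wpM2l; first by apply: mulr_ge0 => //; exact: sqr_ge0.
by apply: normal_pdf_ub; rewrite mulf_neq0.
Qed.

Lemma integrable_sqr_normal_pdf :
  mu.-integrable setT (fun x => ((x - m) ^+ 2 * p x)%:E).
Proof.
apply: (@le_integrable _ _ _ mu setT _ _ (fun x => (16 * s ^+ 2)%:E * (normal_pdf m (2 * s) x)%:E)%E) => //.
- apply/measurable_EFinP/measurable_funM; last exact: measurable_normal_pdf.
  by apply: measurable_funX; exact: measurable_funB.
- move=> x _; rewrite -EFinM !abse_EFin lee_fin.
  have pge0 c y : 0 <= normal_pdf m c y by exact: normal_pdf_ge0.
  rewrite ger0_norm; last by apply: mulr_ge0 => //; exact: sqr_ge0.
  by apply: le_trans (ler_norm _); exact: sqr_normal_pdf_le.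
- by apply: integrableZl => //; exact: integrable_normal_pdf.
Qed.

Lemma integrable_mul_normal_pdf (f : R -> R) (c : R) :
  measurable_fun setT f -> (forall x, `|f x| <= c * (1 + (x - m) ^+ 2)) ->
  mu.-integrable setT (fun x => (f x * p x)%:E).
Proof.
move=> mf fc.
apply: (@le_integrable _ _ _ mu setT _ _
  (fun x => c%:E * ((p x)%:E + ((x - m) ^+ 2 * p x)%:E))%E) => //.
- by apply/measurable_EFinP/measurable_funM => //; exact: measurable_normal_pdf.
- move=> x _; rewrite -EFinD -EFinM !abse_EFin lee_fin.
  apply: le_trans (ler_norm _); rewrite normrM.
  rewrite [`|p x|]ger0_norm ?normal_pdf_ge0//.
  have -> : c * (p x + (x - m) ^+ 2 * p x) = c * (1 + (x - m) ^+ 2) * p x by ring.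
  by rewrite ler_wpM2r ?normal_pdf_ge0.
- apply: integrableZl => //; apply: integrableD => //.
    exact: integrable_normal_pdf.
  exact: integrable_sqr_normal_pdf.
Qed.

(** Supplies the decay hypothesis of [Rintegral_derive_eq0]: the antiderivatives used below are the
    density times a factor of at most affine growth. *)
Lemma normal_pdf_decay : exists K, forall x, (1 + `|x - m|) * p x * `|x| <= K.
Proof.
have [K HK] := sqr_normal_pdf_ub.
exists (2 * (1 + `|m|) * (normal_peak s + K)) => x.
have p0 : 0 <= p x by exact: normal_pdf_ge0.
have n0 := normr_ge0 m; have y0 := normr_ge0 (x - m).
have xy : `|x| <= `|x - m| + `|m| by rewrite -[in leLHS](subrK m x) ler_normD.
have pK : p x + `|x - m| ^+ 2 * p x <= normal_peak s + K.
  by rewrite lerD ?normal_pdf_ub// real_normK ?num_real.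
apply: (@le_trans _ _ ((1 + `|x - m|) * p x * (`|x - m| + `|m|))).
  by apply: ler_wpM2l xy; apply: mulr_ge0 => //; rewrite addr_ge0.
apply: (@le_trans _ _ (2 * (1 + `|m|) * (p x + `|x - m| ^+ 2 * p x))); last first.
  by apply: ler_wpM2l pK; rewrite mulr_ge0// addr_ge0.
rewrite -subr_ge0; set a := `|m|; set y := `|x - m|; set q := p x.
(* The difference is exhibited as a sum of visibly nonnegative terms. *)
have -> : 2 * (1 + a) * (q + y ^+ 2 * q) - (1 + y) * q * (y + a) =
  ((1 + a) * (1 - y) ^+ 2 + (1 + y) * (1 + a * y)) * q by ring.
apply: mulr_ge0 => //; apply: addr_ge0; apply: mulr_ge0.
- by rewrite addr_ge0.
- exact: sqr_ge0.
- by rewrite addr_ge0.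
- by apply: addr_ge0 => //; exact: mulr_ge0.
Qed.

Local Lemma dominated_by_decay (F : R -> R) (c : R) :
  (forall x, `|F x| <= c * ((1 + `|x - m|) * p x)) ->
  exists K, forall x, `|F x| * `|x| <= K.
Proof.
have [K HK] := normal_pdf_decay; move=> Fc; exists (`|c| * K) => x.
apply: (@le_trans _ _ (`|c| * ((1 + `|x - m|) * p x * `|x|))); last exact: ler_wpM2l.
rewrite mulrA; apply: ler_wpM2r => //; apply: le_trans (Fc x) _.
apply: ler_wpM2r (ler_norm _); apply: mulr_ge0; last exact: normal_pdf_ge0.
by rewrite addr_ge0.
Qed.

Lemma continuous_affine (c d : R) : continuous (fun y : R => c * y + d).
Proof.
by move=> x; apply: cvgD; [apply: cvgM; [exact: cvg_cst|exact: cvg_id]|exact: cvg_cst].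
Qed.

Lemma normal_pdf_mean : (\int[mu]_x ((x - m) * p x))%R = 0.
Proof.
(* [- s^2 p] is an antiderivative of [(x - m) p]. *)
have [|K HK] := @dominated_by_decay (fun x => - (s ^+ 2) * p x) (s ^+ 2).
  move=> x; rewrite normrM normrN [`|s ^+ 2|]ger0_norm ?sqr_ge0//.
  apply: ler_wpM2l; first exact: sqr_ge0.
  rewrite ger0_norm ?normal_pdf_ge0// ler_peMl ?normal_pdf_ge0//.
  by rewrite lerDl.
apply: (Rintegral_derive_eq0 _ _ _ HK).
- move=> x; have D := is_derive1M (is_derive_cst (- s ^+ 2) x (1 : R)) (is_derive_normal_pdf x).
  by apply: (is_derive_eq D) => /=; field.
- move=> x; apply: cvgM; last exact: continuous_normal_pdf.
  have := @continuous_affine 1 (- m) x; under eq_fun do rewrite mul1r; exact.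
- apply: (@integrable_mul_normal_pdf _ 1).
    exact: measurable_funB.
  move=> x; rewrite mul1r; move: (x - m) => y.
  by rewrite -[y ^+ 2]real_normK ?num_real//; have := normr_ge0 y; move: `|y| => z; nra.
Qed.

Lemma normal_pdf_variance : (\int[mu]_x ((x - m) ^+ 2 * p x))%R = s ^+ 2.
Proof.
(* The derivative of [- s^2 (x - m) p] is [((x - m)^2 - s^2) p], so the variance is compared with
   the total mass. *)
have [|K HK] := @dominated_by_decay (fun x => (- (s ^+ 2) * (1 * x - m)) * p x) (s ^+ 2).
  move=> x; rewrite mul1r 2!normrM normrN [`|s ^+ 2|]ger0_norm ?sqr_ge0//.
  rewrite -mulrA; apply: ler_wpM2l; first exact: sqr_ge0.
  have p0 := normal_pdf_ge0 m s x.
  by rewrite [`|p x|]ger0_norm//; apply: ler_wpM2r => //; rewrite lerDr.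
have c2 : continuous (fun x => (x - m) ^+ 2).
  move=> x; under eq_fun do rewrite expr2.
  by apply: cvgM; have := @continuous_affine 1 (- m) x; under eq_fun do rewrite mul1r.
have f0 : (\int[mu]_x (((x - m) ^+ 2 - s ^+ 2) * p x))%R = 0.
  apply: (Rintegral_derive_eq0 _ _ _ HK).
  - move=> x; have D := is_derive1M (is_derive1M (is_derive_cst (- s ^+ 2) x (1 : R))
      (is_derive1_affine 1 (- m) x)) (is_derive_normal_pdf x).
    by apply: (is_derive_eq D) => /=; field.
  - move=> x; apply: cvgM; last exact: continuous_normal_pdf.
    by apply: cvgB; [exact: c2|exact: cvg_cst].
  - apply: (@integrable_mul_normal_pdf _ (1 + s ^+ 2)).
      by apply: measurable_funB => //; exact: continuous_measurable_fun.
    move=> x; rewrite ler_norml; have := sqr_ge0 (x - m); have := sqr_ge0 s.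
    by move: (_ ^+ 2) (_ ^+ 2) => u v u0 v0; nra.
have i2 := integrable_sqr_normal_pdf.
have ip : mu.-integrable setT (fun x => (s ^+ 2 * p x)%:E).
  by under eq_fun do rewrite EFinM; apply: integrableZl => //; exact: integrable_normal_pdf.
move: f0; under eq_Rintegral do rewrite mulrBl.
rewrite RintegralB// RintegralZl//; last exact: integrable_normal_pdf.
move=> /eqP; rewrite subr_eq0 => /eqP ->.
by rewrite /Rintegral integral_normal_pdf mulr1.
Qed.

(** Stein's identity for the test function sin(t x + b), from the antiderivative
    [s^2 sin(t x + b) p]. It closes the differential equation of [normal_pdf_cos]. *)
Lemma normal_pdf_by_parts (t b : R) :
  (\int[mu]_x ((- (x - m) * sin (t * x + b)) * p x))%R =
  - (s ^+ 2 * t) * (\int[mu]_x (cos (t * x + b) * p x))%R.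
Proof.
have mlin : continuous (fun x => t * x + b) by exact: continuous_affine.
have csin : continuous (fun x => sin (t * x + b)).
  by move=> x; apply: (cvg_comp _ _ (mlin x)); exact: continuous_sin.
have ccos : continuous (fun x => cos (t * x + b)).
  by move=> x; apply: (cvg_comp _ _ (mlin x)); exact: continuous_cos.
have csub : continuous (fun x => x - m).
  by move=> x; have := @continuous_affine 1 (- m) x; under eq_fun do rewrite mul1r.
have [|K HK] := @dominated_by_decay (fun x => (s ^+ 2 * (sin \o (fun x => t * x + b)) x) * p x) (s ^+ 2).
  move=> x /=; rewrite 2!normrM [`|s ^+ 2|]ger0_norm ?sqr_ge0//.
  rewrite -mulrA; apply: ler_wpM2l; first exact: sqr_ge0.
  have p0 := normal_pdf_ge0 m s x.
  rewrite [`|p x|]ger0_norm//; apply: ler_wpM2r => //.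
  by apply: le_trans (sin_max _) _; rewrite lerDl.
have i1 : mu.-integrable setT (fun x => ((- (x - m) * sin (t * x + b)) * p x)%:E).
  apply: (@integrable_mul_normal_pdf _ 1).
    apply: measurable_funM; apply: continuous_measurable_fun => //.
    by move=> x; apply: cvgN; exact: csub.
  move=> x; rewrite normrM normrN mul1r -[(x - m) ^+ 2]real_normK ?num_real//.
  have := normr_ge0 (x - m); have := normr_ge0 (sin (t * x + b)); have := sin_max (t * x + b).
  by move: `|x - m| `|sin _| => u v; nra.
have i2 : mu.-integrable setT (fun x => (cos (t * x + b) * p x)%:E).
  apply: (@integrable_mul_normal_pdf _ 1); first exact: continuous_measurable_fun.
  by move=> x; rewrite mul1r; apply: le_trans (cos_max _) _; rewrite lerDl sqr_ge0.
have i3 : mu.-integrable setT (fun x => ((s ^+ 2 * t) * (cos (t * x + b) * p x))%:E).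
  by under eq_fun do rewrite EFinM; exact: integrableZl.
have f0 : (\int[mu]_x (((s ^+ 2 * t) * (cos (t * x + b) * p x)
    + (- (x - m) * sin (t * x + b)) * p x)))%R = 0.
  apply: (Rintegral_derive_eq0 _ _ _ HK).
  - move=> x; have D := is_derive1M (is_derive1M (is_derive_cst (s ^+ 2) x (1 : R))
      (is_derive1_comp (is_derive_sin _) (is_derive1_affine t b x))) (is_derive_normal_pdf x).
    by apply: (is_derive_eq D) => /=; move: (sin _) (cos _) => ? ?; field.
  - move=> x; apply: cvgD; apply: cvgM; [exact: cvg_cst| |..|exact: continuous_normal_pdf].
      by apply: cvgM; [exact: ccos|exact: continuous_normal_pdf].
    by apply: cvgM; [apply: cvgN; exact: csub|exact: csin].
  - by apply: integrableD i3 i1.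
move: f0; rewrite RintegralD//.
rewrite RintegralZl// => /eqP; rewrite addrC addr_eq0 => /eqP ->.
by rewrite mulNr.
Qed.

End normal_pdf_calculus.

Section normal_characteristic_function.
Context (R : realType) (s : R).
Hypothesis s0 : s != 0.
Local Notation mu := (@lebesgue_measure R).
Local Notation p := (normal_pdf 0 s).

Lemma integrable_cos_normal_pdf (t b : R) :
  mu.-integrable setT (fun x => (cos (t * x + b) * p x)%:E).
Proof.
apply: (@integrable_mul_normal_pdf _ _ _ s0 _ 1).
  apply: continuous_measurable_fun => x.
  apply: (cvg_comp _ _ (@continuous_affine _ t b x)); exact: continuous_cos.
by move=> x; rewrite mul1r; apply: le_trans (cos_max _) _; rewrite lerDl sqr_ge0.
Qed.

(** Differentiation under the integral, dominated by [|x| p x], and Stein's identity give phi'(u) =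
    - s^2 u phi(u), with phi(0) = cos b. *)
Lemma normal_pdf_cos (t b : R) :
  (\int[mu]_x (cos (t * x + b) * p x))%R = cos b * expR (- (s ^+ 2 * t ^+ 2 / 2)).
Proof.
pose phi (u : R) := (\int[mu]_x (cos (u * x + b) * p x))%R.
have dcos (x u : R) : is_derive u (1 : R) (fun y => cos (y * x + b) * p x)
    (- x * sin (u * x + b) * p x).
  have D := is_derive1M (is_derive1_comp (is_derive_cos _) (is_derive1_affine x b u))
    (is_derive_cst (p x) u (1 : R)).
  rewrite (_ : (fun y => _) = (fun y => (cos \o (fun y => x * y + b)) y * cst (p x) y)).
    by apply: (is_derive_eq D); rewrite /= mulr0 addr0 (mulrC u x); ring.
  by apply/funext => y /=; rewrite (mulrC x).
have dphi (u : R) : is_derive u (1 : R) phi (- (s ^+ 2 * u) * phi u).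
  have mG : measurable_fun setT (fun x : R => `|x|) by exact: normr_measurable.
  have iG : mu.-integrable setT (fun x => (`|x| * p x)%:E).
    apply: (@integrable_mul_normal_pdf _ 0 _ s0 _ 1) => //.
    move=> x; rewrite mul1r subr0 normr_id -[x ^+ 2]real_normK ?num_real//.
    by have := normr_ge0 x; move: `|x| => y; nra.
  have hu : `](u - 1), (u + 1)[%classic u by rewrite /= in_itv /= ltrBlDr ltrDl ltr01.
  have hi (x : R) (_ : `](u - 1), (u + 1)[%classic x) :
    mu.-integrable setT (EFin \o (fun y => cos (x * y + b) * p y)).
    exact: integrable_cos_normal_pdf.
  have hd (x y : R) (_ : `](u - 1), (u + 1)[%classic x) (_ : setT y) :
      derivable (fun z : R => cos (z * y + b) * p y) x 1.
    by have [] := dcos y x.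
  have hG (x y : R) (_ : `](u - 1), (u + 1)[%classic x) (_ : setT y) :
      `|partial1of2 (fun z y : R => cos (z * y + b) * p y) x y| <= `|y| * p y.
    rewrite partial1of2E; have [_ ->] := dcos y x.
    rewrite 2!normrM normrN [`|p y|]ger0_norm ?normal_pdf_ge0//.
    by apply: ler_wpM2r; [exact: normal_pdf_ge0|rewrite ler_piMr// sin_max].
  have G0 (y : R) : 0 <= `|y| * p y by rewrite mulr_ge0// normal_pdf_ge0.
  have D1 := @derivable_under_integral R _ _ mu _ setT measurableT u _ _ hu hi hd _ G0 iG hG.
  have D2 := @differentiation_under_integral R _ _ mu _ setT measurableT u _ _ hu hi hd _ G0 iG hG.
  apply: DeriveDef; first exact: D1.
  rewrite -derive1E D2.
  under eq_Rintegral.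
    move=> y _; rewrite partial1of2E; have [_ ->] := dcos y u.
    rewrite -[y in - y]subr0; over.
  exact: normal_pdf_by_parts.
(* Integrating factor: [c] has derivative zero, hence equals its value at 0. *)
pose c (u : R) := phi u * expR (s ^+ 2 / 2 * (u * u)).
have dc (u : R) : is_derive u (1 : R) c 0.
  have did := is_derive_id u (1 : R).
  have dq := is_derive1M (is_derive_cst (s ^+ 2 / 2) u (1 : R)) (is_derive1M did did).
  have D := is_derive1M (dphi u) (is_derive1_comp (is_derive_expR _) dq).
  by apply: (is_derive_eq D) => /=; field.
have := is_derive_0_is_cst t 0 dc.
rewrite /c !mulr0 expR0 mulr1 {2}/phi.
under [RHS]eq_Rintegral do rewrite mul0r add0r.
rewrite RintegralZl//; last exact: integrable_normal_pdf.
rewrite [X in cos b * X]/Rintegral integral_normal_pdf mulr1 => <-.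
rewrite -/(phi t) -[RHS]mulrA -expRD (_ : _ + _ = 0) ?expR0 ?mulr1//.
by field.
Qed.

End normal_characteristic_function.

Section real_integrable.
Context d (T : measurableType d) (R : realType) (mu : {measure set T -> \bar R}).
Implicit Types f g : T -> R.

Lemma integrableD_EFin f g : mu.-integrable setT (EFin \o f) ->
  mu.-integrable setT (EFin \o g) -> mu.-integrable setT (EFin \o (fun x => f x + g x)).
Proof. by move=> fi gi; exact: integrableD fi gi. Qed.

Lemma integrableZl_EFin c f : mu.-integrable setT (EFin \o f) ->
  mu.-integrable setT (EFin \o (fun x => c * f x)).
Proof. by move=> fi; exact: integrableZl fi. Qed.

Lemma eq_integrable_EFin f g : f =1 g -> mu.-integrable setT (EFin \o f) ->
  mu.-integrable setT (EFin \o g).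
Proof. by move=> /funext ->. Qed.

End real_integrable.

Section gaussian_variables.
Context d (T : measurableType d) (R : realType) (P : probability T R).
Implicit Types (X : {RV P >-> R}) (f : R -> R).

Lemma is_gaussian0_ae X m : is_gaussian P X m 0 -> {ae P, forall w, X w = m}.
Proof.
move=> [_ HX]; exists (X @^-1` (~` [set m])); split.
- by rewrite -[X @^-1` _]setTI; apply: measurable_funPT => //; exact: measurableC.
- rewrite HX; last exact: measurableC.
  rewrite /gaussian_law eqxx diracE; congr (_%:E).
  by rewrite memNset//= => /(_ erefl).
- by move=> w.
Qed.

(* [normal_prob] lives on [measurableTypeR R], whose display differs from that of
   the canonical structure on [R]. *)
Let toR X : {mfun T >-> measurableTypeR R} :=
  HB.pack (X : T -> measurableTypeR R)
    (isMeasurableFun.Build _ _ T (measurableTypeR R) X (measurable_funPT X)).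

Let integral_toR X m v (g : measurableTypeR R -> \bar R) :
  is_gaussian P X m v -> 0 < v ->
  (\int[distribution P (toR X)]_y g y = \int[normal_prob m (Num.sqrt v)]_y g y)%E.
Proof.
move=> [_ HX] v0; apply: eq_measure_integral => A mA _.
by transitivity (P (X @^-1` A)) => //; rewrite HX// /gaussian_law gt_eqF.
Qed.

Lemma integrable_gaussian X m v f : is_gaussian P X m v -> 0 < v ->
  measurable_fun setT f ->
  lebesgue_measure.-integrable setT (fun x => (f x * normal_pdf m (Num.sqrt v) x)%:E) ->
  P.-integrable setT (EFin \o (f \o X)).
Proof.
move=> HX v0 mf fi.
have := integrable_normal_prob mf fi => /integrableP[_ ni].
apply/integrableP; split.
  by apply/measurable_EFinP; exact: measurableT_comp.
have := @ge0_integral_distribution _ _ _ _ _ P (toR X) (fun x => `|(f x)%:E|%E).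
move=> /= <- //; first by rewrite (integral_toR _ HX v0).
by apply/measurable_EFinP; exact: measurableT_comp.
Qed.

Lemma Rintegral_gaussian X m v f : is_gaussian P X m v -> 0 < v ->
  measurable_fun setT f ->
  lebesgue_measure.-integrable setT (fun x => (f x * normal_pdf m (Num.sqrt v) x)%:E) ->
  (\int[P]_w f (X w))%R =
  (\int[lebesgue_measure]_x (f x * normal_pdf m (Num.sqrt v) x))%R.
Proof.
move=> HX v0 mf fi; have iX := integrable_gaussian HX v0 mf fi.
rewrite -Rintegral_normal_prob//; congr fine.
have := @integral_distribution _ _ _ _ _ P (toR X) (EFin \o f).
move=> /= <- //; first by rewrite (integral_toR _ HX v0).
exact/measurable_EFinP.
Qed.

Lemma ae_Rintegral_cst (g : T -> R) (c : R) : measurable_fun setT g ->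
  {ae P, forall w, g w = c} -> (\int[P]_w g w)%R = c.
Proof.
move=> mg gc; rewrite /Rintegral (ae_eq_integral (cst c%:E))//.
- by rewrite /= integral_cst//= probability_setT mule1.
- exact/measurable_EFinP.
- by apply: filterS gc => w /= -> _.
Qed.

Lemma ae_integrable_cst (g : T -> R) (c : R) : measurable_fun setT g ->
  {ae P, forall w, g w = c} -> P.-integrable setT (EFin \o g).
Proof.
move=> mg gc; apply/integrableP; split; first exact/measurable_EFinP.
rewrite (ae_eq_integral (cst `|c|%:E))//.
- by rewrite /= integral_cst//= probability_setT mule1 ltry.
- by apply/measurable_EFinP; exact: measurableT_comp.
- by apply: filterS gc => w /= -> _.
Qed.

Lemma gaussian_moments X m v : is_gaussian P X m v ->
  [/\ P.-integrable setT (EFin \o X),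
      P.-integrable setT (EFin \o (fun w => X w ^+ 2)),
      (\int[P]_w X w)%R = m &
      (\int[P]_w (X w ^+ 2))%R = v + m ^+ 2].
Proof.
move=> HX; have [v0 _] := HX.
have mX2 : measurable_fun setT (fun w => X w ^+ 2) by exact: measurable_funX.
have [v00|vn0] := eqVneq v 0.
  move: HX; rewrite v00 add0r => /is_gaussian0_ae Xm.
  have X2m : {ae P, forall w, X w ^+ 2 = m ^+ 2} by apply: filterS Xm => w ->.
  by split; [exact: ae_integrable_cst Xm|exact: ae_integrable_cst X2m|
    exact: ae_Rintegral_cst|exact: ae_Rintegral_cst].
have {v0 vn0} v0 : 0 < v by rewrite lt_neqAle eq_sym vn0.
have s0 : Num.sqrt v != 0 by rewrite gt_eqF// sqrtr_gt0.
have sv : Num.sqrt v ^+ 2 = v by rewrite sqr_sqrtr// ltW.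
have msub : measurable_fun setT (fun x : R => x - m) by exact: measurable_funB.
have i1 : lebesgue_measure.-integrable setT
    (fun x => ((x - m) * normal_pdf m (Num.sqrt v) x)%:E).
  apply: (@integrable_mul_normal_pdf _ _ _ s0 _ 1) => // x.
  rewrite mul1r; move: (x - m) => y; rewrite -[y ^+ 2]real_normK ?num_real//.
  by have := normr_ge0 y; move: `|y| => z; nra.
have i2 := integrable_sqr_normal_pdf m s0.
have msub2 : measurable_fun setT (fun x : R => (x - m) ^+ 2) by exact: measurable_funX.
have iX1 := integrable_gaussian HX v0 msub i1.
have iX2 := integrable_gaussian HX v0 msub2 i2.
have E1 : (\int[P]_w (X w - m))%R = 0.
  by rewrite (Rintegral_gaussian HX v0 msub i1) normal_pdf_mean.
have E2 : (\int[P]_w ((X w - m) ^+ 2))%R = v.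
  by rewrite (Rintegral_gaussian HX v0 msub2 i2) normal_pdf_variance.
have ic c : P.-integrable setT (EFin \o cst c) by exact: finite_measure_integrable_cst.
have Ec c : (\int[P]_w c)%R = c by rewrite Rintegral_cst//= probability_setT mulr1.
have iX : P.-integrable setT (EFin \o X).
  apply: (eq_integrable_EFin _ (integrableD_EFin iX1 (ic m))) => w /=.
  by rewrite subrK.
have iXs := integrableZl_EFin (2 * m) iX.
have EX : (\int[P]_w X w)%R = m.
  move: E1; rewrite RintegralB//; last exact: ic.
  by rewrite Ec => /eqP; rewrite subr_eq0 => /eqP.
have XE w : X w ^+ 2 = ((X w - m) ^+ 2 + 2 * m * X w) + - m ^+ 2 by ring.
have iS := integrableD_EFin iX2 iXs.
split => //.
  by apply: (eq_integrable_EFin _ (integrableD_EFin iS (ic (- m ^+ 2)))) => w /=; rewrite XE.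
under eq_Rintegral do rewrite XE.
rewrite RintegralD//; last exact: ic.
by rewrite RintegralD// RintegralZl// Ec EX E2; ring.
Qed.

Lemma gaussian_cos X v t b : is_gaussian P X 0 v ->
  (\int[P]_w cos (t * X w + b))%R = cos b * expR (- (v * t ^+ 2 / 2)).
Proof.
move=> HX; have [v0 _] := HX.
have mc : measurable_fun setT (fun x : R => cos (t * x + b)).
  apply: continuous_measurable_fun => x.
  apply: (cvg_comp _ _ (@continuous_affine _ t b x)); exact: continuous_cos.
have [v00|vn0] := eqVneq v 0.
  move: HX; rewrite v00 => /is_gaussian0_ae Xm.
  rewrite !mul0r oppr0 expR0 mulr1; apply: ae_Rintegral_cst.
    by apply: (measurableT_comp mc).
  by apply: filterS Xm => w ->; rewrite mulr0 add0r.
have {v0 vn0} v0 : 0 < v by rewrite lt_neqAle eq_sym vn0.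
have s0 : Num.sqrt v != 0 by rewrite gt_eqF// sqrtr_gt0.
have sv : Num.sqrt v ^+ 2 = v by rewrite sqr_sqrtr// ltW.
rewrite (Rintegral_gaussian HX v0 mc (integrable_cos_normal_pdf s0 t b)).
by rewrite normal_pdf_cos// sv.
Qed.

End gaussian_variables.

(** * Laws determined by trigonometric polynomials *)

Section bounded_convergence.
Context d (T : measurableType d) (R : realType) (P : probability T R).
Implicit Types f : T -> R.

Lemma integrable_bounded f M : measurable_fun setT f ->
  (forall w, `|f w| <= M) -> P.-integrable setT (EFin \o f).
Proof.
move=> mf fM; apply: measurable_bounded_integrable => //.
  by rewrite /= probability_setT ltry.
by exists M; split; [exact: num_real|move=> x Mx w _ /=; apply: le_trans (fM w) (ltW Mx)].
Qed.

Lemma bounded_convergence (f_ : nat -> T -> R) f M :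
  (forall n, measurable_fun setT (f_ n)) -> measurable_fun setT f ->
  (forall n w, `|f_ n w| <= M) ->
  {ae P, forall w, f_ ^~ w @ \oo --> f w} ->
  (\int[P]_w f_ n w)%R @[n --> \oo] --> (\int[P]_w f w)%R.
Proof.
move=> mf_ mf fM ff.
have [|||||fi _ dct] := @dominated_convergence _ _ _ P setT measurableT
  (fun n => EFin \o f_ n) (EFin \o f) (cst M%:E).
- by move=> n; exact/measurable_EFinP.
- exact/measurable_EFinP.
- apply: filterS ff => w fw _ /=.
  by apply: cvg_EFin => //; exact: nearW.
- exact: finite_measure_integrable_cst.
- by apply: aeW => w n _ /=; rewrite lee_fin.
apply: fine_cvg; rewrite fineK//; exact: integrable_fin_num.
Qed.

End bounded_convergence.

(** * Polynomial approximation of the sign *)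

Section smooth_sign.
Context (R : realType).
Implicit Types s u x y : R.

(* [0] and [+-1] are the fixed points of [sgstep] in [-1, 1], and its iterates
   converge there to the sign. *)
Definition sgstep u : R := (3 * u - u * u * u) / 2.
(** The quadratic polynomial that sends -1 and 0 to 0 and 1 to 1: it turns a sign into the indicator
    of positivity, strict at 0. *)
Definition pospart u : R := (u * u + u) / 2.

Lemma sgstepN u : sgstep (- u) = - sgstep u.
Proof. by rewrite /sgstep; ring. Qed.

Lemma iter_sgstepN n u : iter n sgstep (- u) = - iter n sgstep u.
Proof. by elim: n => //= n ->; rewrite sgstepN. Qed.

(** With u the current iterate, 1 - sgstep u = (1 - u) (1 - u/2 - u^2/2), and the second factor is
    at most 1 - s/2 because the iterates never fall below s. *)
Lemma iter_sgstep_bound n s : 0 <= s <= 1 ->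
  s <= iter n sgstep s <= 1 /\ 1 - iter n sgstep s <= (1 - s / 2) ^+ n.
Proof.
move=> /andP[s0 s1]; elim: n => [|n [/andP[IH1 IH2] IH3]].
  by rewrite /= expr0 lexx s1; split=> //; rewrite lerBlDr lerDl.
rewrite /= exprS; move: (iter n sgstep s) (_ ^+ n) IH1 IH2 IH3 => u e su u1 ue.
rewrite /sgstep.
have E : 1 - (3 * u - u * u * u) / 2 = ((1 - u) * (2 + u) / 2) * (1 - u) by field.
have F : (3 * u - u * u * u) / 2 - u = u * (1 - u) * (1 + u) / 2 by field.
have u0 : 0 <= u by exact: le_trans su.
have e0 : 0 <= e by apply: le_trans ue; rewrite subr_ge0.
have B : 0 <= u * (1 - u) * (1 + u) / 2.
  apply: divr_ge0 => //; apply: mulr_ge0; last by rewrite addr_ge0.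
  by apply: mulr_ge0 => //; rewrite subr_ge0.
have C : 0 <= (1 - u) * (2 + u) / 2.
  apply: divr_ge0 => //; apply: mulr_ge0; first by rewrite subr_ge0.
  by rewrite addr_ge0.
split; last first.
  rewrite E; apply: ler_pM => //; first by rewrite subr_ge0.
  by nra.
apply/andP; split; first by rewrite (le_trans su)// -subr_ge0 F.
by rewrite -subr_ge0 E; apply: mulr_ge0 => //; rewrite subr_ge0.
Qed.

Lemma iter_sgstep_norm n s : `|s| <= 1 -> `|iter n sgstep s| <= 1.
Proof.
have H u : 0 <= u -> u <= 1 -> `|iter n sgstep u| <= 1.
  move=> u0 u1; have [|/andP[h1 h2] _] := @iter_sgstep_bound n u; first by rewrite u0.
  by rewrite ger0_norm// (le_trans u0).
rewrite ler_norml => /andP[s1 s2]; have [s0|s0] := leP 0 s; first exact: H.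
rewrite -[s]opprK iter_sgstepN normrN; apply: H; last by rewrite lerNl.
by rewrite oppr_ge0 ltW.
Qed.

Lemma pospart_norm u : `|u| <= 1 -> `|pospart u| <= 1.
Proof. by rewrite !ler_norml /pospart => /andP[u1 u2]; apply/andP; split; nra. Qed.

Lemma cvg_iter_sgstep s : `|s| <= 1 ->
  pospart (iter n sgstep s) @[n --> \oo] --> ((0 < s)%R%:R : R).
Proof.
have H u : 0 < u -> u <= 1 -> iter n sgstep u @[n --> \oo] --> (1 : R).
  move=> u0 u1; have u01 : 0 <= u <= 1 by rewrite ltW.
  apply: (@squeeze_cvgr _ _ _ _ (fun n => 1 - (1 - u / 2) ^+ n) (cst 1)).
  - near=> n; have [/andP[_ h2] h3] := iter_sgstep_bound n u01.
    by rewrite h2 andbT lerBlDr -lerBlDl.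
  - rewrite -[X in _ --> X]subr0; apply: cvgB; first exact: cvg_cst.
    by apply: cvg_expr; rewrite ger0_norm; lra.
  - exact: cvg_cst.
have C (v : nat -> R) l : v n @[n --> \oo] --> l -> pospart (v n) @[n --> \oo] --> pospart l.
  move=> vl; apply: cvgM; last exact: cvg_cst.
  by apply: cvgD => //; exact: cvgM.
rewrite ler_norml => /andP[s1 s2]; have [s0|s0|<-] := ltgtP 0 s.
- by have := C _ _ (H _ s0 s2); rewrite (_ : pospart 1 = 1)// /pospart; field.
- have := C _ _ (cvgN (H (- s) _ _)); rewrite (_ : pospart (- 1) = 0); last by rewrite /pospart; ring.
  under eq_fun do rewrite /= iter_sgstepN opprK.
  by apply; [rewrite oppr_gt0|rewrite lerNl].
- rewrite (_ : (fun n => _) = cst 0); first exact: cvg_cst.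
  have it0 n : iter n sgstep 0 = 0.
    by elim: n => //= n ->; rewrite /sgstep !mulr0 subrr mul0r.
  by apply/funext => n; rewrite it0 /pospart mulr0 addr0 mul0r.
Unshelve. all: end_near. Qed.

(** For large m the argument lies in (-2, 2), where the sine has the sign of its argument. This
    replaces the unbounded y by a trigonometric function of y. *)
Lemma near_sin_gt0 y : \forall m \near \oo, (0 < sin (2 ^- m * y)) = (0 < y).
Proof.
have y2 : 2 ^- m * y @[m --> \oo] --> (0 : R).
  rewrite -[X in _ --> X](mul0r y); apply: cvgM; last exact: cvg_cst.
  under eq_fun do rewrite -exprVn; apply: cvg_expr.
  by rewrite ger0_norm// invf_lt1// ltr1n.
have small : \forall m \near \oo, `|2 ^- m * y| < 2.
  by have /cvgr0_norm_lt := y2; apply.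
near=> m.
have : `|2 ^- m * y| < 2 by near: m.
have e0 : 0 < 2 ^- m :> R by rewrite invr_gt0 exprn_gt0.
rewrite ltr_norml => /andP[h1 h2]; have [y0|y0|<-] := ltgtP 0 y.
- by apply: sin2_gt0; rewrite h2 mulr_gt0.
- apply/negbTE; rewrite -leNgt -oppr_ge0 -sinN ltW// sin2_gt0// -mulrN mulr_gt0 ?oppr_gt0//=.
  by rewrite mulrN ltrNl.
- by rewrite mulr0 sin0 ltxx.
Unshelve. all: end_near. Qed.

End smooth_sign.
Arguments sgstep {R} u.
Arguments pospart {R} u.

Section trigonometric_polynomials.
Context (R : realType) (V : finType).
Implicit Types (F G : (V -> R) -> R) (a : V -> R).

(** Each triple holds a coefficient, a frequency vector and a phase. The phases provide the sines,
    and the product-to-sum formula makes the class an algebra, so polynomials such as [sgstep] and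
    [pospart] can be composed with it. *)
Definition trig_poly F := exists s : seq (R * (V -> R) * R), forall f,
  F f = \sum_(c <- s) c.1.1 * cos (\sum_x c.1.2 x * f x + c.2).

Lemma trig_poly_ext F G : F =1 G -> trig_poly F -> trig_poly G.
Proof. by move=> /funext ->. Qed.

Lemma trig_poly_cst c : trig_poly (fun=> c).
Proof.
exists [:: (c, fun=> 0, 0)] => f; rewrite big_seq1 /= addr0 big1 ?cos0 ?mulr1//.
by move=> x _; rewrite mul0r.
Qed.

Lemma trig_polyD F G : trig_poly F -> trig_poly G -> trig_poly (fun f => F f + G f).
Proof. by move=> [s Fs] [t Gt]; exists (s ++ t) => f; rewrite big_cat /= Fs Gt. Qed.

Lemma trig_polyM F G : trig_poly F -> trig_poly G -> trig_poly (fun f => F f * G f).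
Proof.
move=> [s Fs] [t Gt].
exists (flatten [seq [seq (c.1.1 * e.1.1 / 2, fun x => c.1.2 x + e.1.2 x, c.2 + e.2) | e <- t] ++
  [seq (c.1.1 * e.1.1 / 2, fun x => c.1.2 x - e.1.2 x, c.2 - e.2) | e <- t] | c <- s]) => f.
rewrite Fs Gt big_flatten big_map mulr_suml; apply: eq_bigr => c _.
rewrite big_cat /= !big_map -big_split /= mulr_sumr; apply: eq_bigr => e _.
have -> : \sum_x (c.1.2 x + e.1.2 x) * f x = \sum_x c.1.2 x * f x + \sum_x e.1.2 x * f x.
  by rewrite -big_split; apply: eq_bigr => x _; rewrite mulrDl.
have -> : \sum_x (c.1.2 x - e.1.2 x) * f x = \sum_x c.1.2 x * f x - \sum_x e.1.2 x * f x.
  by rewrite -sumrB; apply: eq_bigr => x _; rewrite mulrBl.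
move: (\sum_x _) (\sum_x _) => u v.
have -> : v + u + (c.2 + e.2) = (v + c.2) + (u + e.2) by ring.
have -> : v - u + (c.2 - e.2) = (v + c.2) - (u + e.2) by ring.
by move: (v + c.2) (u + e.2) => p q; rewrite cosD cosB; field.
Qed.

Lemma trig_poly_sin (x : V) (h c : R) : trig_poly (fun f => sin (h * (f x - c))).
Proof.
exists [:: (1, fun y => h * (y == x)%:R, - (h * c) - pi / 2)] => f.
rewrite big_seq1 /= mul1r addrA cosBpihalf (bigD1 x)//= eqxx mulr1 big1.
  by rewrite addr0 mulrBr.
by move=> y /negbTE ->; rewrite mulr0 mul0r.
Qed.

Lemma trig_poly_sgstep n F : trig_poly F -> trig_poly (fun f => iter n sgstep (F f)).
Proof.
move=> tF; elim: n => //= n IH; set G := fun f => iter n sgstep (F f).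
have G3 := trig_polyM (trig_polyM IH IH) IH.
have := trig_polyD (trig_polyM (trig_poly_cst (3 / 2)) IH) (trig_polyM (trig_poly_cst (- 2^-1)) G3).
by apply: trig_poly_ext => f; rewrite /sgstep; field.
Qed.

Lemma trig_poly_pospart F : trig_poly F -> trig_poly (fun f => pospart (F f)).
Proof.
move=> tF; have := trig_polyM (trig_poly_cst 2^-1) (trig_polyD (trig_polyM tF tF) tF).
by apply: trig_poly_ext => f; rewrite /pospart mulrC.
Qed.

Lemma trig_poly_prod I (s : seq I) (F : I -> (V -> R) -> R) :
  (forall i, trig_poly (F i)) -> trig_poly (fun f => \prod_(i <- s) F i f).
Proof.
move=> tF; elim: s => [|i s IH].
  by apply: trig_poly_ext (trig_poly_cst 1) => f; rewrite big_nil.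
by apply: trig_poly_ext (trig_polyM (tF i) IH) => f; rewrite big_cons.
Qed.

End trigonometric_polynomials.

Lemma prod_norm_le1 (R : numDomainType) I (s : seq I) (F : I -> R) :
  (forall i, `|F i| <= 1) -> `|\prod_(i <- s) F i| <= 1.
Proof.
move=> F1; elim: s => [|i s IH]; first by rewrite big_nil normr1.
by rewrite big_cons normrM mulr_ile1.
Qed.

Lemma cvg_prod_seq (R : realType) I (s : seq I) (F : nat -> I -> R) (G : I -> R) :
  (forall i, F n i @[n --> \oo] --> G i) ->
  (\prod_(i <- s) F n i) @[n --> \oo] --> \prod_(i <- s) G i.
Proof.
move=> FG; elim: s => [|i s IH].
  by under eq_fun do rewrite big_nil; rewrite big_nil; exact: cvg_cst.
by under eq_fun do rewrite big_cons; rewrite big_cons; exact: cvgM.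
Qed.

(** * Upper boxes and their approximation by trigonometric polynomials *)

Section boxes.
Context (R : realType) (V : finType).
Implicit Types (l : seq (V * R)).

(** Constraints form a list, repeated coordinates allowed, so that intersecting boxes is
    concatenating lists and the boxes form a pi-system. *)
Definition box l : set (V -> R) := [set f | all (fun p => p.2 < f p.1) l].
Definition boxes : set (set (V -> R)) := range box.

Lemma boxI l1 l2 : box l1 `&` box l2 = box (l1 ++ l2).
Proof.
by apply/seteqP; split => f /=; rewrite /box /= all_cat; [case=> -> ->|move/andP].
Qed.

Lemma setI_closed_boxes : setI_closed boxes.
Proof. by move=> _ _ [l1 _ <-] [l2 _ <-]; exists (l1 ++ l2) => //; rewrite boxI. Qed.

Lemma box_nil : box [::] = setT.
Proof. by apply/seteqP; split. Qed.

Lemma prod_box l f : \prod_(p <- l) (p.2 < f p.1)%R%:R = \1_(box l) f :> R.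
Proof.
rewrite indicE; elim: l => [|p l IH]; first by rewrite big_nil box_nil in_setT.
rewrite big_cons IH -natrM mulnb; congr (nat_of_bool _)%:R.
by apply/idP/idP => [/andP[h1 /set_mem h2]|/set_mem /= /andP[h1 h2]];
  [apply: mem_set; rewrite /box /= h1|rewrite h1; exact: mem_set].
Qed.

Lemma cylinder_sub_boxes : @cylinder_sigma_algebra R V `<=` <<s boxes >>.
Proof.
apply: smallest_sub; first exact: smallest_sigma_algebra.
move=> _ [x [B [mB ->]]].
have mx : measurable_fun [set: g_sigma_algebraType boxes] (fun f : g_sigma_algebraType boxes => (f : V -> R) x).
  apply: (measurability _ (RGenOInfty.measurableE R)) => _ [_ [c ->] <-].
  rewrite setTI; apply: sub_sigma_algebra; exists [:: (x, c)] => //.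
by have := mx measurableT B mB; rewrite setTI.
Qed.

End boxes.

Section trig_poly_integral.
Context (R : realType) (V : finType).
Context d (T : measurableType d) (P : probability T R).
Variable X : V -> {RV P >-> R}.

Lemma measurable_lin (a : V -> R) b :
  measurable_fun setT (fun w => \sum_x a x * X x w + b).
Proof.
apply: measurable_funD => //; apply: measurable_sum => x.
exact: measurable_funM.
Qed.

Lemma measurable_trig_poly F : trig_poly F -> measurable_fun setT (fun w => F (X ^~ w)).
Proof.
move=> [s Fs]; under eq_fun do rewrite Fs; apply: measurable_sum => c.
apply: measurable_funM => //; apply: measurableT_comp (measurable_lin _ _).
apply: continuous_measurable_fun; exact: continuous_cos.
Qed.

Lemma Rintegral_trig_poly (s : seq (R * (V -> R) * R)) :
  (\int[P]_w \sum_(c <- s) c.1.1 * cos (\sum_x c.1.2 x * X x w + c.2))%R =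
  \sum_(c <- s) c.1.1 * (\int[P]_w cos (\sum_x c.1.2 x * X x w + c.2))%R.
Proof.
have ic (c : R * (V -> R) * R) :
    P.-integrable setT (EFin \o (fun w => cos (\sum_x c.1.2 x * X x w + c.2))).
  apply: (@integrable_bounded _ _ _ _ _ 1); last by move=> w; exact: cos_max.
  apply: measurableT_comp (measurable_lin _ _).
  apply: continuous_measurable_fun; exact: continuous_cos.
have isum : forall s : seq (R * (V -> R) * R), P.-integrable setT (EFin \o (fun w =>
    \sum_(c <- s) c.1.1 * cos (\sum_x c.1.2 x * X x w + c.2))).
  elim => [|c r IH].
    apply: (eq_integrable_EFin (f := cst 0)); first by move=> w; rewrite big_nil.
    exact: finite_measure_integrable_cst.
  apply: (eq_integrable_EFin _ (integrableD_EFin (integrableZl_EFin c.1.1 (ic c)) IH)).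
  by move=> w; rewrite big_cons.
elim: s => [|c s IH].
  rewrite big_nil; under eq_Rintegral do rewrite big_nil.
  by rewrite Rintegral_cst// mul0r.
rewrite big_cons; under eq_Rintegral do rewrite big_cons.
rewrite RintegralD//; last exact: integrableZl_EFin.
by rewrite RintegralZl// IH.
Qed.

Lemma measurable_box l : measurable [set w | box l (X ^~ w)].
Proof.
elim: l => [|p l IH]; first by rewrite (_ : [set w | _] = setT)//; apply/seteqP; split.
rewrite (_ : [set w | _] = X p.1 @^-1` `]p.2, +oo[ `&` [set w | box l (X ^~ w)]).
  by apply: measurableI => //; rewrite -[X in measurable X]setTI; exact: measurable_funPT.
by apply/seteqP; split => w; rewrite /box /= in_itv /= andbT; [move/andP|case=> -> ->].
Qed.

Definition smooth_box (m n : nat) (l : seq (V * R)) (f : V -> R) : R :=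
  \prod_(p <- l) pospart (iter n sgstep (sin (2 ^- m * (f p.1 - p.2)))).

Lemma trig_poly_smooth_box m n l : trig_poly (smooth_box m n l).
Proof.
apply: trig_poly_prod => p.
exact: (trig_poly_pospart (trig_poly_sgstep n (trig_poly_sin p.1 (2 ^- m) p.2))).
Qed.

(** The two limits cannot be merged: at fixed m, letting n grow yields the indicator of sin(2^-m (f
    - c)) > 0, and only then does m recover f > c. The intermediate [G] is kept in the statement
    because it is itself determined by integrals of trigonometric polynomials. *)
Lemma cvg_smooth_box l :
  exists G : nat -> R,
    (forall m, (\int[P]_w smooth_box m n l (X ^~ w))%R @[n --> \oo] --> G m) /\
    G m @[m --> \oo] --> fine (P [set w | box l (X ^~ w)]).
Proof.
pose g m (f : V -> R) : R := \prod_(p <- l) (0 < sin (2 ^- m * (f p.1 - p.2)))%R%:R.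
have cg m f : smooth_box m n l f @[n --> \oo] --> g m f.
  by apply: cvg_prod_seq => p; apply: cvg_iter_sgstep; exact: sin_max.
have msb m n : measurable_fun setT (fun w => smooth_box m n l (X ^~ w)).
  by apply: measurable_trig_poly; exact: trig_poly_smooth_box.
have mg m : measurable_fun setT (fun w => g m (X ^~ w)).
  by apply: (measurable_fun_cvg (fun n => msb m n)) => w _; exact: cg.
exists (fun m => \int[P]_w g m (X ^~ w))%R; split => [m|].
  apply: (@bounded_convergence _ _ _ _ _ _ 1) => //; last exact: aeW.
  move=> n w; apply: prod_norm_le1 => p.
  by apply: pospart_norm; apply: iter_sgstep_norm; exact: sin_max.
have mb := measurable_box l.
rewrite (_ : fine _ = \int[P]_w (\1_(box l) (X ^~ w)))%R; last first.
  by rewrite -[in LHS](setIT [set w | _]) -integral_indic//; congr fine.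
have cb f : g m f @[m --> \oo] --> (\1_(box l) f : R).
  rewrite -prod_box; apply: cvg_prod_seq => p; apply: cvg_near_cst.
  by have := near_sin_gt0 (f p.1 - p.2); apply: filterS => m ->; rewrite subr_gt0.
apply: (@bounded_convergence _ _ _ _ _ _ 1) => //.
- exact: measurable_indic.
- by move=> n w; apply: prod_norm_le1 => p; case: (_ < _); rewrite ?normr0 ?normr1.
- by apply: aeW => w; exact: cb.
Qed.

End trig_poly_integral.

(* Cramer-Wold: trigonometric polynomials are integrated alike under both laws,
   hence, by two bounded limits, so are the indicators of upper boxes. *)
Lemma same_law_of_cos (R : realType) (V : finType)
  d (T : measurableType d) (P : probability T R)
  d' (T' : measurableType d') (P' : probability T' R)
  (X : V -> {RV P >-> R}) (Y : V -> {RV P' >-> R}) :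
  (forall (a : V -> R) b, (\int[P]_w cos (\sum_x a x * X x w + b))%R =
                          (\int[P']_w cos (\sum_x a x * Y x w + b))%R) ->
  same_law X Y.
Proof.
move=> XY.
have Ebox l : P [set w | box l (X ^~ w)] = P' [set w | box l (Y ^~ w)].
  have [G [G1 G2]] := cvg_smooth_box X l; have [H [H1 H2]] := cvg_smooth_box Y l.
  have GH : G = H.
    apply/funext => m; have := G1 m; have := H1 m.
    rewrite (_ : (fun n => _) = (fun n => \int[P]_w smooth_box m n l (X ^~ w)))%R.
      by move=> /cvg_lim <-// /cvg_lim <-.
    apply/funext => n; have [s Fs] := trig_poly_smooth_box m n l.
    under eq_Rintegral do rewrite Fs; under [RHS]eq_Rintegral do rewrite Fs.
    by rewrite !Rintegral_trig_poly; apply: eq_bigr => c _; rewrite XY.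
  have : fine (P [set w | box l (X ^~ w)]) = fine (P' [set w | box l (Y ^~ w)]).
    by rewrite -(cvg_lim _ G2)// -(cvg_lim _ H2)// GH.
  move=> E; rewrite -[LHS]fineK ?E ?fineK// fin_num_measure//; exact: measurable_box.
(* The whole process becomes one random element of R^V with the sigma-algebra generated by boxes;
   its distributions are compared on the pi-system. *)
pose B := @boxes R V.
have mproc d1 (T1 : measurableType d1) (P1 : probability T1 R) (Z : V -> {RV P1 >-> R}) :
    measurable_fun setT ((fun w => Z ^~ w) : T1 -> g_sigma_algebraType B).
  apply: (@measurability _ _ T1 (g_sigma_algebraType B) setT _ B erefl) => _ [_ [l _ <-] <-].
  by rewrite setTI; exact: measurable_box.
pose mX : {mfun T >-> g_sigma_algebraType B} := HB.pack ((fun w => X ^~ w) : T -> g_sigma_algebraType B)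
  (isMeasurableFun.Build _ _ _ _ _ (mproc _ _ _ X)).
pose mY : {mfun T' >-> g_sigma_algebraType B} := HB.pack ((fun w => Y ^~ w) : T' -> g_sigma_algebraType B)
  (isMeasurableFun.Build _ _ _ _ _ (mproc _ _ _ Y)).
move=> A /cylinder_sub_boxes BA.
apply: (@measure_unique _ R (g_sigma_algebraType B) B (fun=> setT) erefl
  (@setI_closed_boxes R V) _ _ (distribution P mX) (distribution P' mY)) => //.
- by move=> _; exists [::] => //; exact: box_nil.
- by rewrite bigcup_const//; exists 0%N.
- by move=> _ [l _ <-]; exact: Ebox.
- by move=> _; rewrite /= probability_setT ltry.
Qed.

(** The identity map under the target law is Gaussian with the same cosine expectations;
    [same_law_of_cos] over a one-point index set identifies the two laws. *)
Lemma gaussian_of_cos (R : realType) d (T : measurableType d) (P : probability T R)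
    (X : {RV P >-> R}) v : 0 <= v ->
  (forall t b, (\int[P]_w cos (t * X w + b))%R = cos b * expR (- (v * t ^+ 2 / 2))) ->
  is_gaussian P X 0 v.
Proof.
move=> v0 HX; split => // B mB.
have [P' HP'] : exists P' : probability (measurableTypeR R) R,
    forall A : set R, measurable A -> P' A = gaussian_law 0 v A.
  rewrite /gaussian_law; have [_|_] := eqVneq v 0.
    by exists (dirac (0 : measurableTypeR R)).
  by exists (normal_prob 0 (Num.sqrt v)).
pose Y : {RV P' >-> R} := HB.pack (id : measurableTypeR R -> R)
  (isMeasurableFun.Build _ _ (measurableTypeR R) R id (@measurable_id _ R setT)).
have YG : is_gaussian P' Y 0 v by split => // A mA; exact: HP'.
transitivity (P' (Y @^-1` B)); last exact: HP'.
apply: (@same_law_of_cos R unit _ _ P _ _ P' (fun=> X) (fun=> Y) _ [set f | B (f tt)]).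
  move=> a b; under eq_Rintegral do rewrite (big_pred1 tt)//.
  under [RHS]eq_Rintegral do rewrite (big_pred1 tt)//.
  by rewrite HX (gaussian_cos _ _ YG).
by apply: sub_sigma_algebra; exists tt, B.
Qed.

(** * Independence *)

Section independent_pair.
Context d (T : measurableType d) (R : realType) (P : probability T R).
Variables (X Y : {RV P >-> R}).
Hypothesis XY : forall A B : set R, measurable A -> measurable B ->
  P (X @^-1` A `&` Y @^-1` B) = (P (X @^-1` A) * P (Y @^-1` B))%E.

Let XYfun : T -> R * R := fun w => (X w, Y w).

Let measurable_XYfun : measurable_fun setT XYfun.
Proof. exact: measurable_fun_pair. Qed.

Let pairRV : {mfun T >-> (R * R)%type} :=
  HB.pack XYfun (isMeasurableFun.Build _ _ _ _ XYfun measurable_XYfun).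

(** By uniqueness of the product measure, the joint law is the product of the marginals; Fubini then
    splits the integral. *)
Lemma Rintegral_indep (f g : R -> R) :
  measurable_fun setT f -> measurable_fun setT g ->
  (forall x, `|f x| <= 1) -> (forall x, `|g x| <= 1) ->
  (\int[P]_w (f (X w) * g (Y w)))%R = (\int[P]_w f (X w))%R * (\int[P]_w g (Y w))%R.
Proof.
move=> mf mg f1 g1.
have bounded_distribution (Z : {RV P >-> R}) (h : R -> R) : measurable_fun setT h ->
    (forall x, `|h x| <= 1) ->
    (\int[distribution P Z]_x (h x)%:E = (\int[P]_w h (Z w))%R%:E)%E.
  move=> mh h1; have ih : P.-integrable setT (EFin \o (h \o Z)).
    apply: (@integrable_bounded _ _ _ _ _ 1); first exact: measurableT_comp.
    by move=> w; exact: h1.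
  have := @integral_distribution _ _ _ _ _ P Z (EFin \o h).
  move=> /= -> //; last exact/measurable_EFinP.
  by rewrite fineK//; exact: integrable_fin_num ih.
pose h (z : R * R) := f z.1 * g z.2.
have mh : measurable_fun setT h.
  apply: measurable_funM; apply: measurableT_comp => //.
have h1 z : `|h z| <= 1 by rewrite normrM mulr_ile1.
have E : (\int[distribution P pairRV]_z (h z)%:E = \int[(distribution P X \x distribution P Y)%E]_z (h z)%:E)%E.
  apply: eq_measure_integral => A mA _; apply/esym.
  apply: (@product_measure_unique _ _ _ _ _ (distribution P X) (distribution P Y) (distribution P pairRV)) => //.
have ihP : P.-integrable setT (EFin \o (h \o pairRV)).
  apply: (@integrable_bounded _ _ _ _ _ 1); first exact: measurableT_comp.
  by move=> w; exact: h1.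
have := @integral_distribution _ _ _ _ _ P pairRV (EFin \o h) _ ihP.
rewrite /= E => E2.
have ih : (distribution P X \x distribution P Y)%E.-integrable setT (EFin \o h).
  apply/integrableP; split; first exact/measurable_EFinP.
  apply: (@le_lt_trans _ _ (\int[(distribution P X \x distribution P Y)%E]_z (cst 1%:E) z)%E).
    apply: ge0_le_integral => //.
    - by apply/measurable_EFinP; exact: measurableT_comp.
    - by move=> z _; rewrite /= lee_fin.
  rewrite integral_cst// mul1e.
  have := @product_measure1E _ _ _ _ _ (distribution P X) (distribution P Y) _ _ measurableT measurableT.
  by rewrite setXTT /= => ->; rewrite !probability_setT mule1 ltry.
have E3 := integral12_prod_meas1 ih.
apply: EFin_inj; rewrite {1}/Rintegral fineK; last exact: integrable_fin_num ihP.
rewrite EFinM -(bounded_distribution X f)// -[LHS]E2; last exact/measurable_EFinP.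
rewrite -[LHS]E3 /fubini_F /= -integralZr//; last first.
  by apply: (@integrable_bounded _ _ _ (distribution P X) _ 1).
apply: eq_integral => x _; rewrite -(bounded_distribution Y g)// -integralZl//.
by apply: (@integrable_bounded _ _ _ (distribution P Y) _ 1).
Qed.

End independent_pair.

Section independent_family.
Context d (T : measurableType d) (R : realType) (P : probability T R).
Context (I : eqType) (Z : I -> {RV P >-> R}).
Hypothesis Z_indep : mutually_independent Z.

Definition cylinders (s : seq I) : set (set T) :=
  [set A | exists2 B : I -> set R, (forall i, measurable (B i)) &
    A = \bigcap_(i in [set` s]) (Z i @^-1` B i)].

Lemma measurable_cylinders s : cylinders s `<=` measurable.
Proof.
move=> _ [B mB ->]; apply: fin_bigcap_measurable => [|i _]; first exact: finite_seq.
by rewrite -[X in measurable X]setTI; exact: measurable_funPT.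
Qed.

Lemma setI_closed_cylinders s : setI_closed (cylinders s).
Proof.
move=> _ _ [B mB ->] [C mC ->]; exists (fun i => B i `&` C i).
  by move=> i; exact: measurableI.
by rewrite -bigcapI; apply: eq_bigcapr => i _; rewrite preimage_setI.
Qed.

Lemma setT_cylinders s : cylinders s setT.
Proof.
exists (fun=> setT) => //; apply/esym; rewrite -subTset => w _ i _.
by rewrite preimage_setT.
Qed.

(** The finite measures sending A to P(A n D) and to P(A) P(D) agree on the pi-system of cylinders
    by mutual independence, hence on the sigma-algebra it generates. *)
Lemma indep_cylinders (s : seq I) (j : I) (A : set T) (B : set R) :
  uniq (j :: s) -> <<s cylinders s >> A -> measurable B ->
  P (A `&` Z j @^-1` B) = (P A * P (Z j @^-1` B))%E.
Proof.
move=> js sA mB; set D := Z j @^-1` B.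
have mD : measurable D by rewrite -[D]setTI; exact: measurable_funPT.
have PD : (fine (P D))%:E = P D by rewrite fineK// fin_num_measure.
have r0 : 0 <= fine (P D) by rewrite fine_ge0.
pose r := NngNum r0.
have rE : (r%:num)%:E = P D by exact: PD.
have mE C : mrestr P mD C = P (C `&` D) by [].
have sE C : mscale r P C = (P C * P D)%E by rewrite muleC -rE.
have E : mrestr P mD A = mscale r P A.
  apply: (@g_sigma_algebra_measure_unique _ R T (cylinders s) (@measurable_cylinders s)
    (fun=> setT) (fun=> setT_cylinders s) _ (mrestr P mD) (mscale r P)
    (@setI_closed_cylinders s) _ _ A sA).
  - by rewrite bigcup_const//; exists 0%N.
  (* Mutual independence takes one family of sets for all indices: [C'] puts [B] at j, which leaves
     the cylinder over s unchanged as j is not in s. *)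
  - move=> _ [C mC ->]; pose C' i := if i == j then B else C i.
    have mC' i : measurable (C' i) by rewrite /C'; case: ifP.
    have jnots : j \notin s by case/andP: js.
    have us : uniq s by case/andP: js.
    have -> : \bigcap_(i in [set` s]) Z i @^-1` C i = \bigcap_(i in [set` s]) Z i @^-1` C' i.
      apply: eq_bigcapr => i /= si; rewrite /C' ifN//.
      by apply: contraNN jnots => /eqP <-.
    rewrite [LHS]mE [RHS]sE Z_indep//.
    have -> : \bigcap_(i in [set` s]) Z i @^-1` C' i `&` D =
        \bigcap_(i in [set` j :: s]) Z i @^-1` C' i.
      apply/seteqP; split => w.
        move=> [sw Dw] i /=; rewrite inE => /predU1P[->|si]; last exact: sw.
        by rewrite /C' eqxx.
      move=> jsw; split; first by move=> i /= si; apply: jsw; rewrite /= inE si orbT.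
      by have := jsw j (mem_head _ _); rewrite /= /C' eqxx.
    rewrite Z_indep// big_cons muleC; congr (_ * _)%E.
    by rewrite /C' eqxx.
  - by move=> _; rewrite [X in (X < _)%E]mE setTI (le_lt_trans (probability_le1 P mD))// ltry.
by rewrite -mE E.
Qed.

Definition lincomb (s : seq I) (c : I -> R) (w : T) : R := \sum_(i <- s) c i * Z i w.

Lemma measurable_lincomb_cylinders (s : seq I) (c : I -> R) :
  @measurable_fun _ _ (g_sigma_algebraType (cylinders s)) R setT (lincomb s c).
Proof.
rewrite /lincomb; under eq_fun do rewrite big_seq big_mkcond.
apply: (@measurable_sum _ (g_sigma_algebraType (cylinders s))) => i.
have [si|//] := boolP (i \in s).
apply: measurable_funM => //= _ B mB; rewrite setTI.
apply: sub_sigma_algebra; exists (fun k => if k == i then B else setT).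
  by move=> k; case: ifP.
apply/seteqP; split => w /=.
  by move=> Bw k _ /=; case: eqP => [->//|_].
by move=> /(_ i si) /=; rewrite eqxx.
Qed.

Lemma indep_lincomb (s : seq I) (j : I) (c : I -> R) (A B : set R) :
  uniq (j :: s) -> measurable A -> measurable B ->
  P (lincomb s c @^-1` A `&` Z j @^-1` B) = (P (lincomb s c @^-1` A) * P (Z j @^-1` B))%E.
Proof.
move=> js mA mB; apply: indep_cylinders js _ mB.
rewrite -[X in <<s _ >> X](@setTI T).
exact: (measurable_lincomb_cylinders c measurableT mA).
Qed.

Lemma measurable_lincomb s c : measurable_fun setT (lincomb s c).
Proof. by apply: measurable_sum => i; exact: measurable_funM. Qed.

HB.instance Definition _ s c :=
  isMeasurableFun.Build _ _ _ _ (lincomb s c) (measurable_lincomb s c).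

Variable v : I -> R.
Hypothesis Z_gauss : forall i, is_gaussian P (Z i) 0 (v i).

(** The cosine of the sum splits by the addition formula into independent factors. The sine parts
    are cosines with phase shifted by -pi/2, hence the induction over all phases b; their product
    has mean zero since the centred Z j has mean sine zero. *)
Lemma lincomb_cos (s : seq I) (c : I -> R) (t b : R) : uniq s ->
  (\int[P]_w cos (t * lincomb s c w + b))%R =
  cos b * expR (- ((\sum_(i <- s) c i ^+ 2 * v i) * t ^+ 2 / 2)).
Proof.
elim: s b => [b _|j s IH b js].
  under eq_Rintegral do rewrite /lincomb big_nil mulr0 add0r.
  by rewrite big_nil !mul0r oppr0 expR0 mulr1 Rintegral_cst//= probability_setT mulr1.
have us : uniq s by case/andP: js.
have mcos (h k : R) : measurable_fun setT (fun x : R => cos (h * x + k)).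
  apply: continuous_measurable_fun => x.
  apply: (cvg_comp _ _ (@continuous_affine _ h k x)); exact: continuous_cos.
have E w : cos (t * lincomb (j :: s) c w + b) =
    cos (t * c j * Z j w + 0) * cos (t * lincomb s c w + b) +
    - 1 * (cos (t * c j * Z j w + - (pi / 2)) * cos (t * lincomb s c w + (b - pi / 2))).
  rewrite addr0 cosBpihalf (addrA _ b) cosBpihalf mulN1r -cosD.
  by rewrite /lincomb big_cons; congr cos; ring.
have ind (A B : set R) : measurable A -> measurable B ->
  P (Z j @^-1` A `&` lincomb s c @^-1` B) = (P (Z j @^-1` A) * P (lincomb s c @^-1` B))%E.
  by move=> mA mB; rewrite setIC muleC; exact: indep_lincomb.
have prodE k l : (\int[P]_w (cos (t * c j * Z j w + k) * cos (t * lincomb s c w + l)))%R =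
    cos k * expR (- (v j * (t * c j) ^+ 2 / 2)) *
    (cos l * expR (- ((\sum_(i <- s) c i ^+ 2 * v i) * t ^+ 2 / 2))).
  rewrite (@Rintegral_indep _ _ _ _ (Z j) (lincomb s c) ind
    (fun x => cos (t * c j * x + k)) (fun x => cos (t * x + l)))//.
  - by rewrite (gaussian_cos _ _ (Z_gauss j)) IH.
  - by move=> x; exact: cos_max.
  - by move=> x; exact: cos_max.
have iprod k l : P.-integrable setT (EFin \o (fun w =>
    cos (t * c j * Z j w + k) * cos (t * lincomb s c w + l))).
  apply: (@integrable_bounded _ _ _ _ _ 1).
    by apply: measurable_funM; apply: (measurableT_comp (mcos _ _)).
  by move=> w; rewrite normrM mulr_ile1// cos_max.
under eq_Rintegral do rewrite E.
rewrite RintegralD//; last exact: integrableZl_EFin.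
rewrite RintegralZl// !prodE cos0 cosN cos_pihalf !mul0r mulr0 addr0 mul1r.
rewrite big_cons mulrCA -expRD; congr (_ * expR _); ring.
Qed.

End independent_family.

(** * The subdivided walk and the lazy walk *)

Section lazy_walk_recursion.
Context (R : realType) (V : finType) (adj : rel V).
Implicit Types x y z : V.

Lemma lazy_prob0 x y : lazy_prob R adj 0 x y = (x == y)%:R.
Proof.
rewrite /lazy_prob (eq_bigl (fun=> x == y)).
  case: (x == y); last by rewrite big_pred0_eq.
  by rewrite (big_pred1 [tuple])// => s; apply/esym/eqP; exact: tuple0.
by move=> s; rewrite [s]tuple0.
Qed.

Lemma lazy_probS k x y :
  lazy_prob R adj k.+1 x y = \sum_z lazy_step R adj x z * lazy_prob R adj k z y.
Proof.
rewrite /lazy_prob.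
rewrite (reindex (fun p : V * k.-tuple V => cons_tuple p.1 p.2)); last first.
  exists (fun s => (thead s, behead_tuple s)) => [[z s] _ |s _] /=.
    by rewrite theadE; congr pair; exact: val_inj.
  by rewrite [RHS]tuple_eta; exact: val_inj.
under [RHS]eq_bigr do rewrite mulr_sumr.
by rewrite pair_big_dep.
Qed.

End lazy_walk_recursion.

Section subdivision_walk.
Context (R : realType) (V : finType) (adj : rel V).
Hypothesis adj_sym : symmetric adj.
Hypothesis adj_irr : irreflexive adj.
Local Notation W := (subdiv adj).
Local Notation pi := (@sub_pi R V adj).
Local Notation sgn := (@sub_sign R V adj).
Local Notation Q := (@sub_Qop R V adj).
Implicit Types (a b c : W) (f g : W -> R) (x y : V).

Lemma adj_neq x y : adj x y -> x != y.
Proof. by apply: contraTneq => ->; rewrite adj_irr. Qed.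

(** The edges at x are in bijection with its neighbours through y |-> {x, y}, which is injective on
    neighbours because adj has no loops. *)
Lemma sum_edges x (F : {set V} -> R) :
  \sum_(e : edge adj | x \in val e) F (val e) = \sum_(y | adj x y) F [set x; y]%SET.
Proof.
pose N := [set [set x; y]%SET | y in adj x]%SET.
have inN A : (A \in N) = (A \in edges adj) && (x \in A).
  apply/imsetP/andP => [[y xy ->]|[]].
    split; last by rewrite set21.
    by rewrite inE; apply/existsP; exists x; apply/existsP; exists y; rewrite eqxx andbT.
  rewrite inE => /existsP[u /existsP[v /andP[uv /eqP ->]]].
  rewrite !inE => /orP[/eqP ->|/eqP ->]; first by exists v.
  by exists u; [rewrite /in_mem /= adj_sym|rewrite finset.setUC].
transitivity (\sum_(A in N) F A).
  rewrite (reindex_omap (val : edge adj -> _) insub) => [|A]; last first.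
    by rewrite inN => /andP[AE _]; rewrite insubT.
  by apply: eq_bigl => e; rewrite inN (valP e) valK eqxx andbT.
rewrite big_imset //= => y z xy xz /setP E.
have := E y; rewrite !inE eqxx orbT eq_sym (negbTE (adj_neq xy)).
by move/esym/eqP.
Qed.

Lemma card_sum (T : finType) (p : pred T) : (#|p|%:R : R) = \sum_(i : T) (p i)%:R.
Proof.
rewrite -sum1_card natr_sum big_mkcond /=.
by apply: eq_bigr => i _; rewrite unfold_in; case: (p i).
Qed.

Lemma sub_piE a : pi a = \sum_b (sub_adj a b)%:R.
Proof. by rewrite /sub_pi /deg cardsE card_sum. Qed.

Lemma deg_sum x : (deg adj x)%:R = \sum_(y | adj x y) 1 :> R.
Proof. by rewrite /deg cardsE -sum1_card natr_sum. Qed.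

Lemma sub_pi_inl x : pi (inl x) = (deg adj x)%:R.
Proof.
rewrite sub_piE big_sumType /= big1 ?add0r// deg_sum -(sum_edges x (fun=> 1)).
by rewrite [RHS]big_mkcond; apply: eq_bigr => e _; case: (x \in val e).
Qed.

Lemma edgeP (e : edge adj) : exists x y, adj x y /\ val e = [set x; y]%SET.
Proof.
have := valP e; rewrite inE => /existsP[x /existsP[y /andP[xy /eqP E]]].
by exists x, y.
Qed.

Lemma sum_edge (f : V -> R) x y :
  adj x y -> \sum_z (z \in [set x; y]%SET)%:R * f z = f x + f y.
Proof.
move=> xy; rewrite (bigD1 x)//= (bigD1 y) 1?eq_sym ?adj_neq//= !inE !eqxx orbT !mul1r.
rewrite big1 ?addr0// => z /andP[zx zy].
by rewrite !inE (negbTE zx) (negbTE zy) mul0r.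
Qed.

Lemma sub_pi_inr (e : edge adj) : pi (inr e) = 2.
Proof.
rewrite sub_piE big_sumType /= [X in _ + X]big1 ?addr0//.
have [x [y [xy E]]] := edgeP e.
transitivity (\sum_z (z \in val e)%:R * 1 : R).
  by apply: eq_bigr => z _; rewrite mulr1.
by rewrite E; exact: (sum_edge (fun=> 1) xy).
Qed.

Lemma sub_adjC a b : sub_adj a b = sub_adj b a.
Proof. by case: a b => [?|?] [?|?]. Qed.

Lemma sub_signM a : sgn a * sgn a = 1.
Proof. by case: a => ? /=; rewrite ?mulr1// mulrNN mulr1. Qed.

Lemma sub_adj_sign a b : sub_adj a b -> sgn b = - sgn a.
Proof. by case: a b => [?|?] [?|?] //= _; rewrite opprK. Qed.

Hypothesis deg_gt0 : forall x, (0 < deg adj x)%N.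

Lemma sub_pi_gt0 a : 0 < pi a.
Proof. by case: a => [x|e]; rewrite ?sub_pi_inl ?sub_pi_inr// ltr0n. Qed.

Lemma sub_pi_neq0 a : pi a != 0.
Proof. by rewrite gt_eqF// sub_pi_gt0. Qed.

Lemma sub_Qop1 : Q (cst 1) = cst 1.
Proof.
apply/funext => a; rewrite /sub_Qop /=; under eq_bigr do rewrite mulr1.
by rewrite /sub_Q -mulr_suml -sub_piE divff// sub_pi_neq0.
Qed.

Lemma sub_Qop_sign : Q sgn = \- sgn.
Proof.
apply/funext => a /=; transitivity (\sum_b sub_Q R a b * (- sgn a)).
  apply: eq_bigr => b _; rewrite /sub_Q; case: (boolP (sub_adj a b)) => [/sub_adj_sign ->//|_].
  by rewrite !mul0r.
rewrite -mulr_suml; have := congr1 (@^~ a) sub_Qop1; rewrite /sub_Qop /=.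
by under eq_bigr do rewrite mulr1; move=> ->; rewrite mul1r.
Qed.

(** Detailed balance: pi(a) Q(a, b) is the adjacency indicator, which is symmetric. *)
Lemma sub_Qop_selfadjoint f g : sub_dot (Q f) g = sub_dot f (Q g).
Proof.
transitivity (\sum_a \sum_b (sub_adj a b)%:R * (f b * g a)).
  apply: eq_bigr => a _; rewrite /sub_Qop mulrA mulr_sumr mulr_suml; apply: eq_bigr => b _.
  by rewrite /sub_Q; field; exact: sub_pi_neq0.
rewrite exchange_big /=; apply: eq_bigr => a _.
rewrite /sub_Qop !mulr_sumr; apply: eq_bigr => b _.
by rewrite /sub_Q sub_adjC; field; exact: sub_pi_neq0.
Qed.

Lemma iter_Qop_selfadjoint k f g : sub_dot (iter k Q f) g = sub_dot f (iter k Q g).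
Proof. by elim: k f g => //= k IH f g; rewrite sub_Qop_selfadjoint IH -iterSr. Qed.

Definition dlt b : W -> R := fun c => (c == b)%:R.
Definition qk k a b : R := iter k Q (dlt b) a.

Lemma sub_dotC f g : sub_dot f g = sub_dot g f.
Proof. by apply: eq_bigr => a _; rewrite (mulrC (f a)). Qed.

Lemma sub_dot_dlt f b : sub_dot f (dlt b) = pi b * f b.
Proof.
rewrite /sub_dot (bigD1 b)//= /dlt eqxx mulr1 big1 ?addr0// => a /negbTE ->.
by rewrite !mulr0.
Qed.

Lemma qk_rev k a b : pi a * qk k a b = pi b * qk k b a.
Proof. by rewrite -!sub_dot_dlt iter_Qop_selfadjoint sub_dotC. Qed.

Lemma iter_Qop_sum k f a : iter k Q f a = \sum_b qk k a b * f b.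
Proof.
apply: (mulfI (sub_pi_neq0 a)); rewrite -sub_dot_dlt iter_Qop_selfadjoint mulr_sumr.
by apply: eq_bigr => b _; rewrite -/(qk k b a) mulrCA qk_rev [LHS]mulrC mulrA.
Qed.

Lemma iter_Qop1 k : iter k Q (cst 1) = cst 1.
Proof. by elim: k => //= k ->; exact: sub_Qop1. Qed.

Lemma sub_QopZ (c : R) f : Q (fun a => c * f a) = (fun a => c * Q f a).
Proof.
by apply/funext => a; rewrite /sub_Qop mulr_sumr; apply: eq_bigr => b _; rewrite mulrCA.
Qed.

Lemma iter_Qop_sign k : iter k Q sgn = (fun a => (-1) ^+ k * sgn a).
Proof.
elim: k => [|k IH]; first by apply/funext => a; rewrite expr0 mul1r.
by rewrite iterS IH sub_QopZ sub_Qop_sign; apply/funext => a /=; rewrite exprS; ring.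
Qed.

Lemma sum_qk k a : \sum_b qk k a b = 1.
Proof.
have := congr1 (@^~ a) (iter_Qop1 k); rewrite /= iter_Qop_sum /=.
by under eq_bigr do rewrite mulr1.
Qed.

Lemma sum_qk_sign k a : \sum_b qk k a b * sgn b = (-1) ^+ k * sgn a.
Proof. by rewrite -iter_Qop_sum iter_Qop_sign. Qed.

Lemma qkD k l a b : qk (k + l) a b = \sum_c qk k a c * qk l c b.
Proof. by rewrite /qk iterD iter_Qop_sum. Qed.

(** The walk picks an edge at x, then one of its two ends; one of these is x itself, which returns
    half of the mass and produces the laziness. *)
Lemma sub_Qop2_inl (f : W -> R) x :
  Q (Q f) (inl x) = \sum_z lazy_step R adj x z * f (inl z).
Proof.
have dx : (deg adj x)%:R != 0 :> R by rewrite pnatr_eq0 -lt0n.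
have -> : Q (Q f) (inl x) = \sum_(e : edge adj | x \in val e)
    (\sum_z (z \in val e)%:R * f (inl z)) / (2 * (deg adj x)%:R).
  rewrite {1}/sub_Qop big_sumType /= big1 ?add0r; last by move=> z _; rewrite /sub_Q !mul0r.
  rewrite [RHS]big_mkcond /=; apply: eq_bigr => e _.
  rewrite /sub_Q /= sub_pi_inl; case: ifP => xe; last by rewrite !mul0r.
  rewrite /sub_Qop big_sumType /= [X in _ + X]big1 ?addr0; last first.
    by move=> z _; rewrite /sub_Q !mul0r.
  rewrite mulr_sumr mulr_suml; apply: eq_bigr => z _.
  by rewrite /sub_Q sub_pi_inr /=; field.
rewrite (sum_edges x (fun A => (\sum_z (z \in A)%:R * f (inl z)) / (2 * (deg adj x)%:R))).
transitivity (\sum_(y | adj x y) (f (inl x) + f (inl y)) / (2 * (deg adj x)%:R)).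
  by apply: eq_bigr => y xy; rewrite (sum_edge (fun z => f (inl z)) xy).
under eq_bigr do rewrite mulrDl.
rewrite big_split /= [in RHS](bigD1 x)//=; congr (_ + _).
  rewrite /lazy_step eqxx.
  transitivity (f (inl x) / (2 * (deg adj x)%:R) * (deg adj x)%:R); last by field.
  by rewrite {3}deg_sum mulr_sumr; apply: eq_bigr => y _; rewrite mulr1.
rewrite big_mkcond [RHS]big_mkcond; apply: eq_bigr => y _ /=.
rewrite /lazy_step eq_sym; case: (boolP (adj x y)) => [xy|nxy].
  by rewrite (adj_neq xy) (negbTE (adj_neq xy)) mulrC.
by case: eqP => //= _; rewrite mul0r.
Qed.

Lemma qk_lazy k x y : qk (k + k) (inl x) (inl y) = lazy_prob R adj k x y.
Proof.
elim: k x => [|k IH] x; first by rewrite lazy_prob0.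
rewrite addSn addnS /qk !iterS sub_Qop2_inl lazy_probS.
by apply: eq_bigr => z _; rewrite -IH.
Qed.

Lemma card_edge : #|{: edge adj}| = #|edges adj|.
Proof. by rewrite card_sig. Qed.

(** The handshake lemma, read off from the orthogonality of 1 and w. *)
Lemma sum_deg : \sum_x (deg adj x)%:R = 2 * #|edges adj|%:R :> R.
Proof.
have := @sub_sign_dot1 R V adj; rewrite big_sumType /=.
under eq_bigr do rewrite mulr1 sub_pi_inl; under [X in _ + X]eq_bigr do rewrite mulrN1 sub_pi_inr.
rewrite sumrN => /eqP; rewrite subr_eq0 => /eqP ->.
by rewrite sumr_const card_edge -[LHS]mulr_natr.
Qed.

Lemma sum_sub_pi : \sum_a pi a = 4 * #|edges adj|%:R.
Proof.
rewrite big_sumType /=; under eq_bigr do rewrite sub_pi_inl.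
under [X in _ + X]eq_bigr do rewrite sub_pi_inr.
rewrite sum_deg sumr_const card_edge -[X in _ + X]mulr_natr; ring.
Qed.

Lemma lazy_prob_rev k x y :
  (deg adj x)%:R * lazy_prob R adj k x y = (deg adj y)%:R * lazy_prob R adj k y x.
Proof. by rewrite -!qk_lazy -!sub_pi_inl qk_rev. Qed.

Lemma sum_lazy_step x : \sum_y lazy_step R adj x y = 1.
Proof.
have := sub_Qop2_inl (cst 1) x; rewrite !sub_Qop1 /= => E; rewrite [RHS]E.
by apply: eq_bigr => y _; rewrite mulr1.
Qed.

Hypothesis has_edge : (0 < #|edges adj|)%N.

Let S : R := \sum_a pi a.
Let S0 : S != 0.
Proof. by rewrite /S sum_sub_pi mulf_neq0// pnatr_eq0 -?lt0n. Qed.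

(** 1 and w are orthogonal and both have squared norm S; the coefficients come from testing the
    residual against each. *)
Lemma sub_projE f a : sub_proj f a =
  (\sum_b pi b * f b) / S + (\sum_b pi b * (f b * sgn b)) / S * sgn a.
Proof.
have [[c [c' pE]] orth] := @sub_projP R V adj f.
have sgnS : \sum_b pi b * sgn b = 0 by exact: sub_sign_dot1.
have E1 : \sum_b pi b * f b = c * S.
  have /orth : span_one_sign (cst 1 : W -> R).
    by exists 1, 0 => b; rewrite mul0r addr0.
  rewrite /sub_dot /= => /eqP.
  under eq_bigr do rewrite mulr1 pE mulrBr mulrDr (mulrC _ c) (mulrCA _ c').
  by rewrite sumrB big_split /= -!mulr_sumr sgnS mulr0 addr0 subr_eq0 => /eqP.
have E2 : \sum_b pi b * (f b * sgn b) = c' * S.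
  have /orth : span_one_sign (sgn : W -> R).
    by exists 0, 1 => b; rewrite mul1r add0r.
  rewrite /sub_dot => /eqP.
  have E b : pi b * ((f b - sub_proj f b) * sgn b) =
      pi b * (f b * sgn b) - (c * (pi b * sgn b) + c' * pi b).
    transitivity (pi b * (f b * sgn b) - (c * (pi b * sgn b) + c' * pi b * (sgn b * sgn b))).
      by rewrite pE; ring.
    by rewrite sub_signM mulr1.
  under eq_bigr do rewrite E.
  by rewrite sumrB big_split /= -!mulr_sumr sgnS mulr0 add0r subr_eq0 => /eqP.
by rewrite E1 E2 !mulfK// pE.
Qed.

(** Self-adjointness moves Q^k from the point mass onto 1 and w, where it acts as multiplication by
    1 and (-1)^k. *)
Lemma xi_kernelE k a b : xi_kernel R k a b =
  qk k a b - pi b / S * (1 + (-1) ^+ k * (sgn a * sgn b)).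
Proof.
rewrite /xi_kernel /entry /= sub_projE -/(dlt b) -/(qk k a b); congr (_ - _).
have -> : \sum_c pi c * iter k Q (dlt b) c = pi b.
  have := iter_Qop_selfadjoint k (dlt b) (cst 1); rewrite iter_Qop1 /sub_dot /=.
  under eq_bigr do rewrite mulr1; move=> ->.
  by rewrite -/(sub_dot (dlt b) (cst 1)) sub_dotC sub_dot_dlt mulr1.
have -> : \sum_c pi c * (iter k Q (dlt b) c * sgn c) = pi b * ((-1) ^+ k * sgn b).
  rewrite -/(sub_dot (iter k Q (dlt b)) sgn) iter_Qop_selfadjoint sub_dotC sub_dot_dlt.
  by rewrite iter_Qop_sign.
by field.
Qed.

(** Reversibility turns the product of the two Q^k into Q^2k, that is, k lazy steps. The projection
    terms sum to -2/S - 2/S + 2/S = -2/S, and S = 4|E| makes this -1/(2|E|) = -pi(y)/deg(y). *)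
Lemma xi_kernel_covariance k x y :
  \sum_b xi_kernel R k (inl x) b * xi_kernel R k (inl y) b / pi b =
  (lazy_prob R adj k x y - stationary R adj y) / (deg adj y)%:R.
Proof.
pose e : R := (-1) ^+ k.
have ee : e * e = 1 by rewrite /e -expr2 sqrr_sign.
have E b : xi_kernel R k (inl x) b * xi_kernel R k (inl y) b / pi b =
    (pi (inl y))^-1 * (qk k (inl x) b * qk k b (inl y))
    - S^-1 * (qk k (inl x) b + e * (qk k (inl x) b * sgn b))
    - S^-1 * (qk k (inl y) b + e * (qk k (inl y) b * sgn b))
    + S^-1 * S^-1 * (2 * pi b + (2 * e) * (pi b * sgn b)).
  rewrite !xi_kernelE /= -/e !mul1r.
  have py := sub_pi_neq0 (inl y); have pb := sub_pi_neq0 b.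
  have -> : qk k b (inl y) = pi (inl y) * qk k (inl y) b / pi b.
    by rewrite qk_rev mulrC mulKf.
  (* The relations e^2 = sgn^2 = 1 are not field identities, so they are inserted by hand before
     [field]. *)
  have -> : 2 * pi b = pi b * (1 + (e * e) * (sgn b * sgn b)).
    by rewrite ee sub_signM; ring.
  by field; rewrite S0 pb py.
under eq_bigr do rewrite E.
rewrite !(big_split, sumrN) /= -!mulr_sumr !big_split /= -!mulr_sumr -qkD !sum_qk !sum_qk_sign.
rewrite sub_sign_dot1 -/S -/e qk_lazy sub_pi_inl /= /stationary !mulr1.
have -> : e * e = 1 by [].
have dy : (deg adj y)%:R != 0 :> R by rewrite pnatr_eq0 -lt0n.
have E0 : #|edges adj|%:R != 0 :> R by rewrite pnatr_eq0 -lt0n.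
by rewrite /S sum_sub_pi; field; rewrite dy E0.
Qed.

End subdivision_walk.

Lemma finType_pos_lower_bound (R : realType) (I : finType) (F : I -> R) :
  (forall i, 0 < F i) -> exists2 e, 0 < e & forall i, e <= F i.
Proof.
move=> F0; case: (pickP (fun _ : I => true)) => [i0 _|noI]; last first.
  by exists 1 => // i; have := noI i.
case: (@arg_minP _ _ _ i0 (fun=> true) F isT) => i _ Hi.
by exists (F i) => // j; exact: Hi.
Qed.

Lemma bernoulli_ineq (R : realType) (x : R) n : 0 <= x <= 1 -> 1 - n%:R * x <= (1 - x) ^+ n.
Proof.
move=> /andP[x0 x1]; elim: n => [|n IH]; first by rewrite mul0r subr0 expr0.
rewrite exprS; apply: (@le_trans _ _ ((1 - x) * (1 - n%:R * x))); last first.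
  by apply: ler_wpM2l => //; rewrite subr_ge0.
rewrite -subr_ge0 -natr1.
have -> : (1 - x) * (1 - n%:R * x) - (1 - (n%:R + 1) * x) = n%:R * x ^+ 2 by ring.
by rewrite mulr_ge0// sqr_ge0.
Qed.

(** * Geometric mixing *)

Section lazy_walk_mixing.
Context (R : realType) (V : finType) (adj : rel V).
Hypothesis adj_sym : symmetric adj.
Hypothesis adj_irr : irreflexive adj.
Hypothesis adj_conn : forall x y, connect adj x y.
Hypothesis deg_gt0 : forall x, (0 < deg adj x)%N.
Hypothesis has_edge : (0 < #|edges adj|)%N.
Local Notation step := (lazy_step R adj).
Local Notation p := (lazy_prob R adj).
Implicit Types x y z : V.

Lemma lazy_step_ge0 x y : 0 <= step x y.
Proof.
rewrite /lazy_step; case: ifP => _; first by rewrite invr_ge0.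
by case: ifP => // _; rewrite invr_ge0 mulr_ge0.
Qed.

Lemma lazy_prob_ge0 k x y : 0 <= p k x y.
Proof.
elim: k x => [|k IH] x; first by rewrite lazy_prob0; case: (x == y).
by rewrite lazy_probS; apply: sumr_ge0 => z _; rewrite mulr_ge0// lazy_step_ge0.
Qed.

Lemma lazy_probD k l x y : p (k + l) x y = \sum_z p k x z * p l z y.
Proof.
elim: k x => [|k IH] x.
  rewrite (bigD1 x)//= lazy_prob0 eqxx mul1r big1 ?addr0// => z /negbTE zx.
  by rewrite lazy_prob0 eq_sym zx mul0r.
rewrite addSn lazy_probS; under eq_bigr do rewrite IH mulr_sumr.
rewrite exchange_big /=; apply: eq_bigr => z _; rewrite lazy_probS mulr_suml.
by apply: eq_bigr => u _; rewrite mulrA.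
Qed.

Lemma sum_lazy_prob k x : \sum_y p k x y = 1.
Proof.
elim: k x => [|k IH] x.
  rewrite (bigD1 x)//= lazy_prob0 eqxx big1 ?addr0// => z /negbTE zx.
  by rewrite lazy_prob0 eq_sym zx.
under eq_bigr do rewrite lazy_probS.
rewrite exchange_big /=; under eq_bigr do rewrite -mulr_sumr IH mulr1.
exact: sum_lazy_step.
Qed.

Lemma lazy_prob_le1 k x y : p k x y <= 1.
Proof.
rewrite -(sum_lazy_prob k x) (bigD1 y)//= lerDl sumr_ge0// => z _.
exact: lazy_prob_ge0.
Qed.

Lemma lazy_probS_gt0 k x y z : 0 < step x z -> 0 < p k z y -> 0 < p k.+1 x y.
Proof.
move=> xz zy; rewrite lazy_probS (bigD1 z)//= ltr_pwDl ?mulr_gt0// sumr_ge0// => u _.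
by rewrite mulr_ge0 ?lazy_step_ge0 ?lazy_prob_ge0.
Qed.

(** By laziness the walk can wait at x, so positivity persists. This gives all pairs a common time
    horizon and excludes periodicity. *)
Lemma lazy_prob_mono k l x y : (k <= l)%N -> 0 < p k x y -> 0 < p l x y.
Proof.
move=> /subnK <-; elim: (l - k)%N => //= n IH pk; rewrite addSn.
apply: (@lazy_probS_gt0 _ _ _ x); last exact: IH.
by rewrite /lazy_step eqxx invr_gt0.
Qed.

Lemma lazy_prob_reach x y : exists k, 0 < p k x y.
Proof.
have /connectP[s] := adj_conn x y; elim: s x => [x _ ->|z s IH x /= /andP[xz zs] yE].
  by exists 0%N; rewrite lazy_prob0 eqxx.
have [k kP] := IH z zs yE; exists k.+1; apply: lazy_probS_gt0 kP.
rewrite /lazy_step xz; case: ifP => _; first by rewrite invr_gt0.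
by rewrite invr_gt0 mulr_gt0 ?ltr0n.
Qed.

Lemma lazy_prob_doeblin : exists N (e : R), 0 < e /\ forall x y, e <= p N.+1 x y.
Proof.
have [f fP] := choice (fun u : V * V => lazy_prob_reach u.1 u.2).
(* The sum bounds every reaching time at once; taking [N.+1] steps makes the block length
   positive. *)
pose N := (\sum_u f u)%N.
have pN x y : 0 < p N.+1 x y.
  apply: lazy_prob_mono (fP (x, y)); apply: leqW.
  by rewrite /N (bigD1 (x, y))//= leq_addr.
have [e e0 eP] := @finType_pos_lower_bound R (V * V)%type (fun u => p N.+1 u.1 u.2) (fun u => pN u.1 u.2).
by exists N, e; split=> // x y; exact: (eP (x, y)).
Qed.

(** Let M and m be where p_k(., y) is largest and smallest. After N steps a mass at least e sits at
    m, so the new values are at most max - e (max - min), and averaging never goes below min. *)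
Lemma doeblin_contraction N e k y c : 0 <= e -> (forall x z, e <= p N x z) ->
  (forall x x', p k x y - p k x' y <= c) ->
  forall x x', p (N + k) x y - p (N + k) x' y <= (1 - e) * c.
Proof.
move=> e0 eP kc x x'.
have [M _ MP] := @arg_maxP _ _ _ x (fun=> true) (p k ^~ y) isT.
have [m _ mP] := @arg_minP _ _ _ x (fun=> true) (p k ^~ y) isT.
have e1 : e <= 1 by apply: le_trans (eP x x) (lazy_prob_le1 _ _ _).
have expand u v : p (N + k) u y - p k v y = \sum_z p N u z * (p k z y - p k v y).
  under eq_bigr do rewrite mulrBr.
  by rewrite sumrB -mulr_suml sum_lazy_prob mul1r -lazy_probD.
have expandN u v : p k v y - p (N + k) u y = \sum_z p N u z * (p k v y - p k z y).
  rewrite -opprB expand -sumrN; apply: eq_bigr => z _.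
  by rewrite -mulrN opprB.
have upper : e * (p k M y - p k m y) <= p k M y - p (N + k) x y.
  rewrite expandN (bigD1 m)//= -[leLHS]addr0; apply: lerD.
    by apply: ler_wpM2r => //; rewrite subr_ge0; exact: mP.
  apply: sumr_ge0 => z _; rewrite mulr_ge0 ?lazy_prob_ge0// subr_ge0.
  exact: MP.
have lower : 0 <= p (N + k) x' y - p k m y.
  rewrite expand; apply: sumr_ge0 => z _; rewrite mulr_ge0 ?lazy_prob_ge0// subr_ge0.
  exact: mP.
have := kc M m; move: (p k M y) (p k m y) upper lower => a b; nra.
Qed.

Lemma lazy_prob_oscillation : exists (C r : R), [/\ 0 <= C, 0 < r, r < 1 &
  forall k x x' y, p k x y - p k x' y <= C * r ^+ k].
Proof.
have [N [e [e0 eP]]] := lazy_prob_doeblin.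
(* The rate r = 1 - h avoids a root of order N+1: Bernoulli's inequality gives 1 - min(e, 1) <= 1 -
   (N+1) h <= r^(N+1). The factor 2 keeps h at most 1/2, so r > 0. *)
pose h := Num.min e 1 / (2 * N.+1%:R).
have m0 : 0 < Num.min e 1 by rewrite lt_min e0 ltr01.
have m1 : Num.min e 1 <= 1 by rewrite ge_min lexx orbT.
have h0 : 0 < h by rewrite divr_gt0// mulr_gt0.
have n1 : 1 <= N.+1%:R :> R by rewrite ler1n.
have n0 : N.+1%:R != 0 :> R by rewrite pnatr_eq0.
have h12 : h <= 2^-1.
  by rewrite /h ler_pdivrMr ?mulr_gt0// mulKf// (le_trans m1).
have nh : N.+1%:R * h = Num.min e 1 / 2 by rewrite /h; field.
have rn : 1 - Num.min e 1 <= (1 - h) ^+ N.+1.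
  apply: le_trans (bernoulli_ineq _ _); last by rewrite (ltW h0) /=; lra.
  by rewrite nh; lra.
have r0 : 0 < 1 - h by lra.
(* With this prefactor the bound is at least 1 for k <= N, where it is trivial; strong induction
   then removes N+1 steps at a time. *)
exists ((1 - h) ^- N.+1), (1 - h); split=> //.
- by rewrite invr_ge0 exprn_ge0// ltW.
- by lra.
elim/ltn_ind => k IH x x' y; have [kN|Nk] := ltnP k N.+1.
  apply: (@le_trans _ _ 1).
    by rewrite lerBlDr (le_trans (lazy_prob_le1 _ _ _))// lerDl lazy_prob_ge0.
  rewrite mulrC ler_pdivlMr ?exprn_gt0// mul1r; apply: ler_wiXn2l; last exact: ltnW.
  - exact: ltW.
  - by lra.
rewrite -(subnKC Nk); set j := (k - N.+1)%N.
have jk : (j < k)%N by rewrite /j ltn_subrL (leq_trans _ Nk).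
have aP u z : Num.min e 1 <= p N.+1 u z by rewrite ge_min eP.
apply: le_trans (doeblin_contraction (ltW m0) aP (fun u v => IH j jk u v y) x x') _.
rewrite exprD [leRHS]mulrCA; apply: ler_wpM2r => //.
by apply: mulr_ge0; [rewrite invr_ge0|]; rewrite exprn_ge0// ltW.
Qed.

Lemma sum_stationary : \sum_x stationary R adj x = 1.
Proof.
rewrite /stationary -mulr_suml sum_deg// divff// mulf_neq0// pnatr_eq0 -lt0n//.
Qed.

Lemma stationary_invariant k y : \sum_x stationary R adj x * p k x y = stationary R adj y.
Proof.
rewrite /stationary; under eq_bigr do rewrite mulrAC lazy_prob_rev// mulrAC.
by rewrite -mulr_sumr sum_lazy_prob mulr1.
Qed.

(** Stationarity writes pi(y) as the pi-average over z of p_k(z, y), so the distance to pi(y) is an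
    average of oscillations. *)
Lemma lazy_prob_mixing : exists (C r : R), [/\ 0 <= C, 0 < r, r < 1 &
  forall k x y, `|p k x y - stationary R adj y| <= C * r ^+ k].
Proof.
have [C [r [C0 r0 r1 H]]] := lazy_prob_oscillation.
exists C, r; split=> // k x y.
have s0 z : 0 <= stationary R adj z by rewrite /stationary divr_ge0.
have E : p k x y - stationary R adj y = \sum_z stationary R adj z * (p k x y - p k z y).
  under eq_bigr do rewrite mulrBr.
  by rewrite sumrB -mulr_suml sum_stationary mul1r stationary_invariant.
have bd : \sum_z stationary R adj z * (C * r ^+ k) = C * r ^+ k.
  by rewrite -mulr_suml sum_stationary mul1r.
rewrite E; apply: le_trans (ler_norm_sum _ _ _) _; rewrite -bd; apply: ler_sum => z _.
rewrite normrM ger0_norm//; apply: ler_wpM2l => //.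
by rewrite ler_norml H andbT lerNl opprB H.
Qed.

End lazy_walk_mixing.

Lemma geometric_series_ub (R : realType) (C r : R) n : 0 <= C -> 0 < r -> r < 1 ->
  \sum_(0 <= k < n) C * r ^+ k <= C / (1 - r).
Proof.
move=> C0 r0 r1; have := @geometric_seriesE R C r; rewrite lt_eqF// => /(_ isT) /(congr1 (@^~ n)).
rewrite /series /geometric /= => ->; rewrite -subr_ge0.
have r1n : 1 - r != 0 by rewrite subr_eq0 gt_eqF.
have -> : C / (1 - r) - C * (1 - r ^+ n) / (1 - r) = C * r ^+ n / (1 - r) by field.
by rewrite divr_ge0 ?mulr_ge0 ?exprn_ge0 ?subr_ge0// ltW.
Qed.

(** * Gaussian series and processes *)

Section gaussian_series.
Context d (T : measurableType d) (R : realType) (P : probability T R).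

(* Geometric decay of the variances makes [\sum_k X_k ^ 2 / r ^ k] integrable, and
   [|X_k| <= X_k ^ 2 / r ^ k + r ^ k]. *)
Lemma gaussian_series_ae (X : nat -> {RV P >-> R}) (v : nat -> R) (C r : R) :
  0 <= C -> 0 < r -> r < 1 -> (forall k, is_gaussian P (X k) 0 (v k)) ->
  (forall k, v k <= C * (r * r) ^+ k) ->
  {ae P, forall w, cvgn (series (fun k => X k w))}.
Proof.
move=> C0 r0 r1 XG vC.
pose g k w : R := r ^- k * X k w ^+ 2.
have rk k : 0 < r ^+ k by rewrite exprn_gt0.
have g0 k w : 0 <= g k w by rewrite mulr_ge0 ?invr_ge0 ?sqr_ge0// ltW.
have mg k : measurable_fun setT (g k).
  by apply: measurable_funM => //; exact: measurable_funX.
(* Of the variance decay (r r)^k, one factor r^k pays for the weight and the other keeps the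
   expectations summable. *)
have ig k : (\int[P]_w (g k w)%:E <= (C * r ^+ k)%:E)%E.
  have [_ i2 _ E2] := gaussian_moments (XG k).
  have i2' := integrableZl_EFin (r ^- k) i2.
  rewrite -[leLHS]fineK; last exact: integrable_fin_num i2'.
  rewrite lee_fin -/(Rintegral _ _ _) RintegralZl// E2 expr0n /= addr0 mulrC.
  by rewrite ler_pdivrMr// -mulrA -exprMn.
pose G w := (\sum_(0 <= k <oo) (g k w)%:E)%E.
have mG : measurable_fun setT G.
  apply: ge0_emeasurable_sum; first by move=> k w _ _; rewrite lee_fin.
  by move=> k _; exact/measurable_EFinP.
have G0 w : (0 <= G w)%E by apply: nneseries_ge0 => k _ _; rewrite lee_fin.
have iG : P.-integrable setT G.
  apply/integrableP; split => //; under eq_integral do rewrite gee0_abs//.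
  rewrite integral_nneseries//; last 2 first.
    by move=> k; exact/measurable_EFinP.
    by move=> k w _; rewrite lee_fin.
  apply: (@le_lt_trans _ _ (C / (1 - r))%:E); last exact: ltry.
  apply: lime_le.
    by apply: is_cvg_nneseries => k _ _; apply: integral_ge0 => w _; rewrite lee_fin.
  apply: nearW => n; apply: (@le_trans _ _ (\sum_(0 <= k < n) (C * r ^+ k)%:E)%E).
    by apply: lee_sum => k _; exact: ig.
  by rewrite sumEFin lee_fin; exact: geometric_series_ub.
have := integrable_ae measurableT iG; apply: filterS => w /(_ I) Gw.
apply: normed_cvg.
apply: (@series_le_cvg _ _ (fun k => g k w + r ^+ k)).
- by move=> k; exact: normr_ge0.
- by move=> k; rewrite addr_ge0// ltW.
- move=> k; rewrite /g /= -[X in _ * X]real_normK ?num_real//.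
  have x0 := normr_ge0 (X k w); move: (rk k) x0; move: `|X k w| (r ^+ k) => x s s0 x0.
  rewrite -subr_ge0; have -> : s^-1 * x ^+ 2 + s - x = ((x - s) ^+ 2 + x * s) / s.
    by field; rewrite gt_eqF.
  by rewrite divr_ge0 ?addr_ge0 ?sqr_ge0 ?mulr_ge0// ltW.
apply: is_cvg_seriesD; last first.
  have := @is_cvg_geometric_series R 1 r; rewrite ger0_norm ?ltW// => /(_ r1).
  by rewrite (_ : geometric 1 r = GRing.exp r)//; apply/funext => k; rewrite /= mul1r.
apply: nondecreasing_is_cvgn.
  by apply/nondecreasing_seqP => n; rewrite !seriesEnat /= big_nat_recr//= lerDl.
exists (fine (G w)) => _ [n _ <-]; rewrite -lee_fin fineK// /series /= -sumEFin.
by apply: nneseries_lim_ge => k _ _; rewrite lee_fin.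
Qed.

End gaussian_series.

(** * Gaussian processes through their linear combinations *)

Section centred_gaussian_processes.
Context d (T : measurableType d) (R : realType) (P : probability T R) (V : finType).
Implicit Types (X : V -> {RV P >-> R}) (K : V -> V -> R) (a : V -> R).

Lemma integrableM_sqr (f g : T -> R) : measurable_fun setT f -> measurable_fun setT g ->
  P.-integrable setT (EFin \o (fun w => f w ^+ 2)) ->
  P.-integrable setT (EFin \o (fun w => g w ^+ 2)) ->
  P.-integrable setT (EFin \o (fun w => f w * g w)).
Proof.
move=> mf mg f2 g2; apply: (@le_integrable _ _ _ P setT _ _
  (EFin \o (fun w => f w ^+ 2 + g w ^+ 2))) => //.
- by apply/measurable_EFinP; exact: measurable_funM.
- move=> w _ /=; rewrite lee_fin normrM [leRHS]ger0_norm ?addr_ge0 ?sqr_ge0//.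
  rewrite -[f w ^+ 2]real_normK ?num_real// -[g w ^+ 2]real_normK ?num_real//.
  have := normr_ge0 (f w); have := normr_ge0 (g w); move: `|f w| `|g w| => u v v0 u0.
  rewrite -subr_ge0; have -> : u ^+ 2 + v ^+ 2 - u * v = (u - v) ^+ 2 + u * v by ring.
  by apply: addr_ge0; [exact: sqr_ge0|exact: mulr_ge0].
- exact: integrableD_EFin.
Qed.

Lemma EFin_expectation (f : T -> R) : P.-integrable setT (EFin \o f) ->
  ('E_P[f] = (\int[P]_w f w)%R%:E)%E.
Proof. by move=> fi; rewrite unlock fineK//; exact: integrable_fin_num fi. Qed.

Lemma sum_delta (x : V) (F : V -> R) : \sum_y (y == x)%:R * F y = F x.
Proof.
rewrite (bigD1 x)//= eqxx mul1r big1 ?addr0// => y /negbTE ->.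
by rewrite mul0r.
Qed.

Lemma integrable_sum_EFin (I : finType) (F : I -> T -> R) :
  (forall i, P.-integrable setT (EFin \o F i)) ->
  P.-integrable setT (EFin \o (fun w => \sum_i F i w)) /\
  (\int[P]_w (\sum_i F i w))%R = \sum_i (\int[P]_w F i w)%R.
Proof.
move=> iF; elim: (index_enum I) => [|i s [IH1 IH2]].
  split.
    apply: (eq_integrable_EFin (f := cst 0)); first by move=> w; rewrite big_nil.
    exact: finite_measure_integrable_cst.
  under eq_Rintegral do rewrite big_nil.
  by rewrite big_nil Rintegral_cst// mul0r.
split.
  by apply: (eq_integrable_EFin _ (integrableD_EFin (iF i) IH1)) => w; rewrite big_cons.
under eq_Rintegral do rewrite big_cons.
by rewrite RintegralD// big_cons IH2.
Qed.

(** The definition leaves the mean and variance of a linear combination unspecified. The marginals,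
    being Gaussian, are square integrable, so both parameters can be computed by expanding the first
    two moments. *)
Lemma centred_gaussian_lincomb X K : centred_gaussian_process K X ->
  forall a, is_gaussian P (fun w => \sum_x a x * X x w) 0
    (\sum_x \sum_y a x * a y * K x y).
Proof.
move=> [XG X0 XK] a.
have XG1 x : exists m v, is_gaussian P (X x) m v.
  have [m [v H]] := XG (fun y => (y == x)%:R); exists m, v.
  by move: H; congr is_gaussian; apply/funext => w; rewrite sum_delta.
have i1 x : P.-integrable setT (EFin \o X x).
  by have [m [v /gaussian_moments[]]] := XG1 x.
have i2 x : P.-integrable setT (EFin \o (fun w => X x w ^+ 2)).
  by have [m [v /gaussian_moments[]]] := XG1 x.
have ixy x y : P.-integrable setT (EFin \o (fun w => X x w * X y w)).
  exact: integrableM_sqr.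
have Ex x : (\int[P]_w X x w)%R = 0.
  by have := X0 x; rewrite EFin_expectation// => -[].
have Exy x y : (\int[P]_w (X x w * X y w))%R = K x y.
  by have := XK x y; rewrite EFin_expectation// => -[].
have [m [v H]] := XG a.
have [_ _ E1 E2] := @gaussian_moments _ _ _ _ (lincomb X (index_enum V) a) _ _ H.
have m0 : m = 0.
  rewrite -E1; have [_ E] := integrable_sum_EFin (fun x => integrableZl_EFin (a x) (i1 x)).
  rewrite /lincomb E big1// => x _.
  by rewrite RintegralZl// Ex mulr0.
suff -> : \sum_x \sum_y a x * a y * K x y = v by move: H; rewrite m0.
move: E2; rewrite m0 expr0n addr0 => <-.
have isum x := integrable_sum_EFin (fun y => integrableZl_EFin (a x * a y) (ixy x y)).
have [_ E] := integrable_sum_EFin (fun x => (isum x).1).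
transitivity (\int[P]_w \sum_x \sum_y a x * a y * (X x w * X y w))%R; last first.
  apply: eq_Rintegral => w _; rewrite expr2 /lincomb mulr_suml; apply: eq_bigr => x _.
  by rewrite mulr_sumr; apply: eq_bigr => y _; rewrite mulrACA.
rewrite E; apply: eq_bigr => x _; rewrite (isum x).2; apply: eq_bigr => y _.
by rewrite RintegralZl// Exy.
Qed.

Lemma gaussian_lincomb_centred X K : (forall x y, K x y = K y x) ->
  (forall a, is_gaussian P (fun w => \sum_x a x * X x w) 0
    (\sum_x \sum_y a x * a y * K x y)) ->
  centred_gaussian_process K X.
Proof.
move=> Ksym XG.
have Kd x y : \sum_u \sum_v (u == x)%:R * (v == y)%:R * K u v = K x y.
  under eq_bigr do under eq_bigr do rewrite -mulrA.
  under eq_bigr do rewrite -mulr_sumr sum_delta.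
  by rewrite sum_delta.
have XG1 x : is_gaussian P (X x) 0 (K x x).
  have := XG (fun y => (y == x)%:R); rewrite Kd.
  by congr is_gaussian; apply/funext => w; rewrite sum_delta.
split=> [a|x|x y]; first by exists 0, (\sum_x \sum_y a x * a y * K x y); exact: XG.
  by have [i1 _ E _] := gaussian_moments (XG1 x); rewrite EFin_expectation// E.
have [_ ix _ Ex] := gaussian_moments (XG1 x); have [_ iy _ Ey] := gaussian_moments (XG1 y).
(* Polarization: the covariance is recovered from the variance of X x + X y. *)
pose a u : R := (u == x)%:R + (u == y)%:R.
have [_ isq _ Es] := @gaussian_moments _ _ _ _ (lincomb X (index_enum V) a) _ _ (XG a).
have ixy : P.-integrable setT (EFin \o (fun w => X x w * X y w)) by exact: integrableM_sqr.
rewrite EFin_expectation//; congr EFin.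
have sE w : lincomb X (index_enum V) a w ^+ 2 = X x w ^+ 2 + (X y w ^+ 2 + 2 * (X x w * X y w)).
  rewrite /lincomb /a; under eq_bigr do rewrite mulrDl.
  by rewrite big_split /= !sum_delta; ring.
have KE : \sum_u \sum_v a u * a v * K u v = K x x + K y y + 2 * K x y.
  transitivity (\sum_u \sum_v (((u == x)%:R * (v == x)%:R * K u v + (u == y)%:R * (v == y)%:R * K u v) +
    ((u == x)%:R * (v == y)%:R * K u v + (u == y)%:R * (v == x)%:R * K u v))).
    by apply: eq_bigr => u _; apply: eq_bigr => v _; rewrite /a; ring.
  under eq_bigr do rewrite !big_split /=.
  by rewrite !big_split /= !Kd (Ksym y x); ring.
move: Es; rewrite KE expr0n /= addr0; under eq_Rintegral do rewrite sE.
have i2xy := integrableZl_EFin 2 ixy.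
rewrite RintegralD//; last exact: integrableD_EFin.
rewrite RintegralD// RintegralZl// Ex Ey !expr0n /= !addr0 => E.
lra.
Qed.

Lemma same_law_gaussian d' (T' : measurableType d') (P' : probability T' R) K X
    (Y : V -> {RV P' >-> R}) :
  (forall a, is_gaussian P (fun w => \sum_x a x * X x w) 0
    (\sum_x \sum_y a x * a y * K x y)) ->
  (forall a, is_gaussian P' (fun w => \sum_x a x * Y x w) 0
    (\sum_x \sum_y a x * a y * K x y)) -> same_law X Y.
Proof.
move=> XG YG; apply: same_law_of_cos => a b.
have := @gaussian_cos _ _ _ _ (lincomb X (index_enum V) a) _ 1 b (XG a).
have := @gaussian_cos _ _ _ _ (lincomb Y (index_enum V) a) _ 1 b (YG a).
rewrite /lincomb; under eq_Rintegral do rewrite mul1r.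
move=> EY; under eq_Rintegral do rewrite mul1r.
by move=> ->; rewrite EY.
Qed.

End centred_gaussian_processes.

(** * Series of independent Gaussian layers *)

Section white_noise_series.
Context d (T : measurableType d) (R : realType) (P : probability T R) (W : finType).
Context (Z : nat -> W -> {RV P >-> R}) (v : W -> R).
Hypothesis Z_indep : mutually_independent (fun i : nat * W => Z i.1 i.2).
Hypothesis Z_gauss : forall k b, is_gaussian P (Z k b) 0 (v b).
Implicit Types (c : nat -> W -> R).

(** Arbitrary coefficients cover, besides xi^k at one vertex, its linear combinations over vertices
    and the truncated series of the tail. *)
Definition layer c k (w : T) : R := \sum_b c k b * Z k b w.
Definition layer_var c k : R := \sum_b c k b ^+ 2 * v b.

Let Zi (i : nat * W) : {RV P >-> R} := Z i.1 i.2.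
Let window (s : seq nat) : seq (nat * W) := [seq (k, b) | k <- s, b <- index_enum W].

Let window_uniq s : uniq s -> uniq (window s).
Proof.
move=> us; apply: allpairs_uniq => //; first exact: index_enum_uniq.
by move=> [a b] [a' b'] _ _ /= [-> ->].
Qed.

Let windowE s c : (fun w => \sum_(k <- s) layer c k w) = lincomb Zi (window s) (fun i => c i.1 i.2).
Proof. by apply/funext => w; rewrite /lincomb big_allpairs_dep. Qed.

Lemma layer_sum_cos (s : seq nat) c t b : uniq s ->
  (\int[P]_w cos (t * (\sum_(k <- s) layer c k w) + b))%R =
  cos b * expR (- ((\sum_(k <- s) layer_var c k) * t ^+ 2 / 2)).
Proof.
move=> us; have := lincomb_cos Z_indep (fun i => Z_gauss i.1 i.2) (fun i => c i.1 i.2) t b (window_uniq us).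
rewrite big_allpairs_dep /= => <-; apply: eq_Rintegral => w _.
by rewrite (congr1 (@^~ w) (windowE s c)).
Qed.

Lemma measurable_layer c k : measurable_fun setT (layer c k).
Proof. by apply: measurable_sum => b; exact: measurable_funM. Qed.

HB.instance Definition _ c k :=
  isMeasurableFun.Build _ _ _ _ (layer c k) (measurable_layer c k).

Lemma layer_var_ge0 c k : 0 <= layer_var c k.
Proof. by apply: sumr_ge0 => b _; rewrite mulr_ge0 ?sqr_ge0//; have [] := Z_gauss k b. Qed.

Lemma layer_gaussian c k : is_gaussian P (layer c k) 0 (layer_var c k).
Proof.
apply: gaussian_of_cos => [|t b]; first exact: layer_var_ge0.
have := @layer_sum_cos [:: k] c t b isT; rewrite big_seq1 => <-.
by apply: eq_Rintegral => w _; rewrite big_seq1.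
Qed.

(** The partial sums satisfy the cosine identity exactly; bounded convergence on the left and
    continuity on the right carry it to the limit, whose law is then known. *)
Lemma layer_series_gaussian c (X : {RV P >-> R}) s :
  {ae P, forall w, series (fun k => layer c k w) @ \oo --> X w} ->
  series (layer_var c) @ \oo --> s -> is_gaussian P X 0 s.
Proof.
move=> cX cs; apply: gaussian_of_cos => [|t b].
  rewrite -(cvg_lim _ cs)//; apply: limr_ge; first by apply/cvg_ex; exists s.
  by apply: nearW => n; apply: sumr_ge0 => k _; exact: layer_var_ge0.
have mcos : measurable_fun setT (fun x : R => cos (t * x + b)).
  apply: continuous_measurable_fun => x.
  apply: (cvg_comp _ _ (@continuous_affine _ t b x)); exact: continuous_cos.
have lim1 : (\int[P]_w cos (t * series (fun k => layer c k w) n + b))%R @[n --> \oo] -->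
    (\int[P]_w cos (t * X w + b))%R.
  apply: (@bounded_convergence _ _ _ _ _ _ 1).
  - move=> n; apply: (measurableT_comp mcos); apply: measurable_sum => k.
    exact: measurable_layer.
  - exact: (measurableT_comp mcos).
  - by move=> n w; exact: cos_max.
  - apply: filterS cX => w cw; apply: (cvg_comp _ cos); last exact: continuous_cos.
    by apply: cvgD; [apply: cvgM; [exact: cvg_cst|exact: cw]|exact: cvg_cst].
have lim2 : cos b * expR (- (series (layer_var c) n * t ^+ 2 / 2)) @[n --> \oo] -->
    cos b * expR (- (s * t ^+ 2 / 2)).
  apply: cvgM; first exact: cvg_cst.
  apply: (cvg_comp _ expR); last exact: continuous_expR.
  apply: cvgN; apply: cvgM; last exact: cvg_cst.
  by apply: cvgM; last exact: cvg_cst.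
move: lim1; rewrite (_ : (fun n => _) = (fun n => cos b * expR (- (series (layer_var c) n * t ^+ 2 / 2)))).
  by move=> /cvg_lim <-//; exact: (cvg_lim _ lim2).
by apply/funext => n; rewrite /series /= layer_sum_cos// iota_uniq.
Qed.

(* the limit of the series where it converges, a junk value elsewhere *)
Definition layer_lim c (w : T) : R :=
  fine (limn_esup (fun n => (series (fun k => layer c k w) n)%:E)).

Lemma measurable_layer_lim c : measurable_fun setT (layer_lim c).
Proof.
apply: measurableT_comp => //; apply: measurable_fun_limn_esup => n.
by apply/measurable_EFinP; apply: measurable_sum => k; exact: measurable_layer.
Qed.

HB.instance Definition _ c :=
  isMeasurableFun.Build _ _ _ _ (layer_lim c) (measurable_layer_lim c).

Lemma layer_limP c (C r : R) : 0 <= C -> 0 < r -> r < 1 ->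
  (forall k, layer_var c k <= C * (r * r) ^+ k) ->
  {ae P, forall w, series (fun k => layer c k w) @ \oo --> layer_lim c w}.
Proof.
move=> C0 r0 r1 cv.
have := @gaussian_series_ae _ _ _ P (layer c) _ _ _ C0 r0 r1 (layer_gaussian c) cv.
apply: filterS => w /cvg_ex [l wl]; rewrite /layer_lim.
have El : (series (fun k => layer c k w) n)%:E @[n --> \oo] --> l%:E.
  by apply: cvg_EFin => //; exact: nearW.
by rewrite (cvg_limn_einf_sup El).2.
Qed.

End white_noise_series.

Lemma Lnorm2_gaussian d (T : measurableType d) (R : realType) (P : probability T R)
    (X : {RV P >-> R}) v : is_gaussian P X 0 v ->
  ('N[P]_(2%:E)[(fun w => (X w)%:E)] = (Num.sqrt v)%:E)%E.
Proof.
move=> XG; have [_ i2 _ E2] := gaussian_moments XG.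
have v0 : 0 <= v by case: XG.
rewrite unlock /=; under eq_integral => w _.
  rewrite powR_mulrn// real_normK ?num_real//; over.
rewrite -[X in (X `^ _)%E]fineK; last exact: integrable_fin_num i2.
by rewrite -/(Rintegral _ _ _) E2 expr0n addr0 poweR_EFin powR12_sqrt.
Qed.

Section white_noise_tail.
Context d (T : measurableType d) (R : realType) (P : probability T R) (W : finType).
Context (Z : nat -> W -> {RV P >-> R}) (v : W -> R).
Hypothesis Z_indep : mutually_independent (fun i : nat * W => Z i.1 i.2).
Hypothesis Z_gauss : forall k b, is_gaussian P (Z k b) 0 (v b).
Implicit Types (c : nat -> W -> R).

(** The error after n terms is a centred Gaussian whose variance is the remainder of the variance
    series, so its L^2 norm is explicit and tends to zero. *)
Lemma layer_tail_L2 c (X : {RV P >-> R}) (s : R) :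
  {ae P, forall w, series (fun k => layer Z c k w) @ \oo --> X w} ->
  series (layer_var v c) @ \oo --> s ->
  ('N[P]_(2%:E)[(fun w => (series (fun k => layer Z c k w) n - X w)%R%:E)]
     @[n --> \oo] --> 0)%E.
Proof.
move=> cX cs.
have tail n : is_gaussian P (fun w => series (fun k => layer Z c k w) n - X w) 0
    (s - series (layer_var v c) n).
  (* the error [S_n - X] is again the sum of a series of layers *)
  pose c' k b := if (n <= k)%N then - c k b else 0.
  have mY : measurable_fun setT (fun w => series (fun k => layer Z c k w) n - X w).
    apply: measurable_funB => //; apply: measurable_sum => k; exact: measurable_layer.
  pose Y : {RV P >-> R} := HB.pack (fun w => series (fun k => layer Z c k w) n - X w)
    (isMeasurableFun.Build _ _ _ _ _ mY).
  have layerE k w : layer Z c' k w = if (n <= k)%N then - layer Z c k w else 0.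
    rewrite /layer /c'; case: ifP => _; first by rewrite -sumrN; apply: eq_bigr => b _; rewrite mulNr.
    by rewrite big1// => b _; rewrite mul0r.
  have layer_varE k : layer_var v c' k = if (n <= k)%N then layer_var v c k else 0.
    rewrite /layer_var /c'; case: ifP => _; first by apply: eq_bigr => b _; rewrite sqrrN.
    by rewrite big1// => b _; rewrite expr0n mul0r.
  have seriesE (f : nat -> R) m : (n <= m)%N ->
      series (fun k => if (n <= k)%N then f k else 0) m = series f m - series f n.
    move=> nm; rewrite sub_series_geq// /series /= (big_cat_nat (leq0n n) nm) /=.
    rewrite [X in X + _]big_nat big1 ?add0r => [|k /andP[_ kn]]; last by rewrite leqNgt kn.
    by apply: eq_big_nat => k /andP[->].
  apply: (@layer_series_gaussian _ _ _ _ _ _ _ Z_indep Z_gauss c' Y).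
    apply: filterS cX => w cw.
    rewrite (_ : (fun k => layer Z c' k w) = fun k => if (n <= k)%N then - layer Z c k w else 0); last first.
      by apply/funext => k; rewrite layerE.
    have : (- series (fun k => layer Z c k w) m + series (fun k => layer Z c k w) n)
        @[m --> \oo] --> - X w + series (fun k => layer Z c k w) n.
      by apply: cvgD; [exact: cvgN|exact: cvg_cst].
    rewrite addrC; apply: cvg_trans; apply: near_eq_cvg; near=> m.
    rewrite seriesE; last by near: m; exact: nbhs_infty_ge.
    by rewrite /series /= !sumrN opprK.
  rewrite (_ : layer_var v c' = fun k => if (n <= k)%N then layer_var v c k else 0); last first.
    by apply/funext => k; rewrite layer_varE.
  have : (series (layer_var v c) m - series (layer_var v c) n)
      @[m --> \oo] --> s - series (layer_var v c) n.
    by apply: cvgB => //; exact: cvg_cst.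
  apply: cvg_trans; apply: near_eq_cvg; near=> m.
  by rewrite seriesE//; near: m; exact: nbhs_infty_ge.
rewrite (_ : (fun n => _) = fun n => (Num.sqrt (s - series (layer_var v c) n))%:E); last first.
  apply/funext => n.
  have mY : measurable_fun setT (fun w => series (fun k => layer Z c k w) n - X w).
    apply: measurable_funB => //; apply: measurable_sum => k; exact: measurable_layer.
  pose Y : {RV P >-> R} := HB.pack (fun w => series (fun k => layer Z c k w) n - X w)
    (isMeasurableFun.Build _ _ _ _ _ mY).
  exact: (@Lnorm2_gaussian _ _ _ _ Y _ (tail n)).
apply: cvg_EFin; first exact: nearW.
rewrite -[X in _ --> X](@sqrtr0 R).
apply: (cvg_comp _ Num.sqrt); last exact: sqrt_continuous.
rewrite -(subrr s); apply: cvgB => //; exact: cvg_cst.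
Unshelve. all: by end_near. Qed.

End white_noise_tail.

Section cvg_sum.
Context (R : realType) (I : finType).

Lemma cvg_series_sum (f : I -> nat -> R) (l : I -> R) :
  (forall i, series (f i) @ \oo --> l i) ->
  series (fun k => \sum_i f i k) @ \oo --> \sum_i l i.
Proof.
move=> fl; rewrite (_ : series _ = fun n => \sum_i series (f i) n); last first.
  by apply/funext => n; rewrite /series /= exchange_big.
elim: (index_enum I) => [|i s IH].
  by under eq_fun do rewrite big_nil; rewrite big_nil; exact: cvg_cst.
by under eq_fun do rewrite big_cons; rewrite big_cons; exact: cvgD.
Qed.

Lemma cvg_seriesZ (a : R) (f : nat -> R) l :
  series f @ \oo --> l -> series (fun k => a * f k) @ \oo --> a * l.
Proof.
move=> fl; rewrite (_ : series _ = fun n => a * series f n); last first.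
  by apply/funext => n; rewrite /series /= mulr_sumr.
by apply: cvgM => //; exact: cvg_cst.
Qed.

End cvg_sum.

Lemma geometric_series_cvg (R : realType) (f : nat -> R) (C r : R) : 0 < r -> r < 1 ->
  (forall k, `|f k| <= C * r ^+ k) -> cvgn (series f).
Proof.
move=> r0 r1 fC; apply: normed_cvg.
apply: (@series_le_cvg _ _ (geometric C r)) => //=.
- by move=> k; exact: le_trans (fC k).
- by apply: is_cvg_geometric_series; rewrite ger0_norm ?ltW.
Qed.

(** * The Green function as a sum of covariances *)

Section green_kernel.
Context (R : realType) (V : finType) (adj : rel V).
Hypothesis adj_sym : symmetric adj.
Hypothesis adj_irr : irreflexive adj.
Hypothesis adj_conn : forall x y, connect adj x y.
Hypothesis adj_edge : exists x y, adj x y.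

Lemma connected_deg_gt0 x : (0 < deg adj x)%N.
Proof.
have ux y : adj x y -> (0 < deg adj x)%N.
  by move=> xy; apply/card_gt0P; exists y; rewrite inE.
have [u [v uv]] := adj_edge; have /connectP [[|y p] /= ] := adj_conn x u.
  by move=> _ xu; apply: (ux v); rewrite -xu.
by move=> /andP[/ux].
Qed.

Lemma edges_gt0 : (0 < #|edges adj|)%N.
Proof.
have [u [v uv]] := adj_edge; apply/card_gt0P; exists [set u; v]%SET.
by rewrite inE; apply/existsP; exists u; apply/existsP; exists v; rewrite uv eqxx.
Qed.

Let K k (x y : V) : R := \sum_(b : subdiv adj) xi_kernel R k (inl x) b * xi_kernel R k (inl y) b / sub_pi R b.

Let KE k x y : K k x y = (deg adj y)%:R^-1 * (lazy_prob R adj k x y - stationary R adj y).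
Proof.
by rewrite mulrC -(xi_kernel_covariance R adj_sym adj_irr connected_deg_gt0 edges_gt0).
Qed.

Lemma xi_kernel_covariance_decay : exists (C r : R), [/\ 0 <= C, 0 < r, r < 1 &
  forall k x y, `|K k x y| <= C * (r * r) ^+ k].
Proof.
have [C [r [C0 r0 r1 H]]] := lazy_prob_mixing R adj_sym adj_irr adj_conn connected_deg_gt0 edges_gt0.
(* The square root puts the mixing rate in the form (r r)^k expected by [layer_limP]; dividing by
   deg(y) >= 1 only improves the bound. *)
exists C, (Num.sqrt r); split => //; first by rewrite sqrtr_gt0.
  by rewrite -sqrtr1 ltr_sqrt.
move=> k x y; rewrite -expr2 sqr_sqrtr; last exact: ltW.
rewrite KE normrM.
apply: le_trans (H k x y); rewrite ler_piMl// ger0_norm ?invr_ge0//.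
by rewrite invf_le1 ?ler1n ?ltr0n connected_deg_gt0.
Qed.

(** [green] is defined with [limn], which is a default value on a divergent series; geometric mixing
    makes it a genuine limit. *)
Lemma green_series x y : series (fun k => K k x y) @ \oo --> green R adj x y.
Proof.
under eq_fun do rewrite KE.
apply: cvg_seriesZ.
have [C [r [C0 r0 r1 H]]] := lazy_prob_mixing R adj_sym adj_irr adj_conn connected_deg_gt0 edges_gt0.
exact: geometric_series_cvg r0 r1 (fun k => H k x y).
Qed.

(** The covariance form of the summands is symmetric at sight, unlike the definition of [green]. *)
Lemma green_sym x y : green R adj x y = green R adj y x.
Proof.
rewrite -(cvg_lim _ (@green_series x y))// -(cvg_lim _ (@green_series y x))//.
congr (limn (series _)); apply/funext => k; apply: eq_bigr => b _.
by rewrite [xi_kernel _ _ _ _ * _]mulrC.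
Qed.

End green_kernel.

(** * Convergence of the series and identification of the field *)

Theorem proposition3p1 (R : realType) (V : finType) (adj : rel V)
    (adj_sym : symmetric adj) (adj_irr : irreflexive adj)
    (adj_conn : forall x y : V, connect adj x y)
    (adj_edge : exists x y : V, adj x y)
    (C0 : R) (C0_gt0 : 0 < C0)
    (d : measure_display) (Omega : measurableType d) (P : probability Omega R)
    (Z : nat -> subdiv adj -> {RV P >-> R})
    (Z_indep : mutually_independent (fun i : nat * subdiv adj => Z i.1 i.2))
    (Z_gauss : forall (k : nat) (a : subdiv adj),
      is_gaussian P (Z k a) 0 (C0 / sub_pi R a)) :
  exists tPsi : V -> {RV P >-> R},
    [/\ forall x : V,
          ((fun n : nat =>
             'N[P]_(2%:E)[(fun w : Omega =>
               ((series (fun k => xi Z k x w) n - tPsi x w)%R)%:E)])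
           @ \oo --> 0)%E,
        forall x : V,
          {ae P, forall w : Omega,
            series (fun k => xi Z k x w) @ \oo --> tPsi x w},
        zero_average_gff adj C0 tPsi &
        forall (d' : measure_display) (Omega' : measurableType d')
               (P' : probability Omega' R) (Psi : V -> {RV P' >-> R}),
          zero_average_gff adj C0 Psi -> same_law tPsi Psi].
Proof.
pose v (b : subdiv adj) : R := C0 / sub_pi R b.
pose c x k (b : subdiv adj) : R := xi_kernel R k (inl x) b.
have [C [r [Cge0 r0 r1 KC]]] := xi_kernel_covariance_decay R adj_sym adj_irr adj_conn adj_edge.
have covE k x y : \sum_b c x k b * c y k b * v b =
    C0 * \sum_b c x k b * c y k b / sub_pi R b.
  by rewrite mulr_sumr; apply: eq_bigr => b _; rewrite /v mulrCA.
have var_bound x k : layer_var v (c x) k <= C0 * C * (r * r) ^+ k.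
  have -> : layer_var v (c x) k = \sum_b c x k b * c x k b * v b by apply: eq_bigr => b _; rewrite expr2.
  by rewrite covE -mulrA ler_pM2l//; apply: le_trans (ler_norm _) (KC k x x).
pose tPsi x : {RV P >-> R} := layer_lim Z (c x).
have C0C : 0 <= C0 * C by apply: mulr_ge0 => //; exact: ltW.
have cvg_tPsi x : {ae P, forall w, series (fun k => xi Z k x w) @ \oo --> tPsi x w}.
  exact: (@layer_limP _ _ _ _ _ _ _ Z_indep Z_gauss (c x) _ _ C0C r0 r1 (var_bound x)).
have cov_series x y : series (fun k => \sum_b c x k b * c y k b * v b) @ \oo --> C0 * green R adj x y.
  under eq_fun do rewrite covE.
  by apply: cvg_seriesZ; exact: green_series.
have tPsi_gaussian a : is_gaussian P (fun w => \sum_x a x * tPsi x w) 0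
    (\sum_x \sum_y a x * a y * (C0 * green R adj x y)).
  (* A linear combination of the limits is again the limit of a layer series, with coefficients
     [ca]; this yields the joint law from the one-dimensional statement. *)
  pose ca k b := \sum_x a x * c x k b.
  apply: (@layer_series_gaussian _ _ _ _ _ _ _ Z_indep Z_gauss ca (lincomb tPsi (index_enum V) a)).
    (* V is finite, so the exceptional null sets of the vertices merge into one. *)
    have : {ae P, forall w, forall x, series (fun k => xi Z k x w) @ \oo --> tPsi x w}.
      exact: filter_forall.
    apply: filterS => w cw.
    rewrite (_ : (fun k => layer Z ca k w) = fun k => \sum_x a x * xi Z k x w).
      by apply: cvg_series_sum => x; exact: cvg_seriesZ.
    apply/funext => k; rewrite /layer /ca; under eq_bigr do rewrite mulr_suml.
    rewrite exchange_big /=; apply: eq_bigr => x _; rewrite mulr_sumr.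
    by apply: eq_bigr => b _; rewrite mulrA.
  rewrite (_ : layer_var v ca = fun k => \sum_x \sum_y a x * a y * \sum_b c x k b * c y k b * v b).
    by apply: cvg_series_sum => x; apply: cvg_series_sum => y; exact: cvg_seriesZ.
  apply/funext => k; under [RHS]eq_bigr do under eq_bigr do rewrite mulr_sumr.
  under [RHS]eq_bigr do rewrite exchange_big /=.
  rewrite exchange_big /=; apply: eq_bigr => b _.
  rewrite /ca expr2 mulr_suml mulr_suml; apply: eq_bigr => x _.
  rewrite mulr_sumr mulr_suml; apply: eq_bigr => y _; ring.
have tPsi_gff : zero_average_gff adj C0 tPsi.
  by apply: gaussian_lincomb_centred => // x y; rewrite (green_sym R adj_sym).
exists tPsi; split => // [x|d' Omega' P' Psi /centred_gaussian_lincomb].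
  apply: (layer_tail_L2 Z_indep Z_gauss (cvg_tPsi x)).
  rewrite (_ : layer_var _ _ = fun k => \sum_b c x k b * c x k b * v b); first exact: cov_series.
  by apply/funext => k; apply: eq_bigr => b _; rewrite expr2.
exact: same_law_gaussian.
Qed.
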